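(* Let $I\subseteq S=\Bbbk[x_1,\ldots,x_n]$ be a monomial ideal over a field $\Bbbk$. Then $S/I$ is Cohen--Macaulay if and only if the real distracting arrangement $V_I(\mathbb R)$ is Cohen--Macaulay over $\Bbbk$. In fact, $S/I$ is Cohen--Macaulay of dimension $d$ if and only if the exponent complexes $\mathrm{E}\Delta_\alpha$ for $\alpha\in\mathbb C^n$ are Cohen--Macaulay over $\Bbbk$ of dimension $d-1$.
   Context: $\Lambda_I\subseteq\mathbb N^n$ is the set of exponent vectors of monomials not in $I$. The distracting arrangement $V_I\subseteq\mathbb C^n$ is the Zariski closure of $\Lambda_I$ in $\mathbb C^n$; it is a finite union of translates of coordinate subspaces $\mathbb C^F$ (vectors supported in $F\subseteq\{1,\ldots,n\}$). The real distracting arrangement is $V_I(\mathbb R)=V_I\cap\mathbb R^n$. For $\alpha\in\mathbb C^n$, let $Z_\alpha$ be the union of the irreducible components of $V_I$ passing through $\alpha$. Then $-\alpha+Z_\alpha$ is a coordinate subspace arrangement, and the exponent simplicial complex is $\mathrm{E}\Delta_\alpha=\{F\subseteq\{1,\ldots,n\}\mid\mathbb C^F\subseteq-\alpha+Z_\alpha\}$. A simplicial complex is Cohen--Macaulay over $\Bbbk$ if its Stanley--Reisner ring over $\Bbbk$ is Cohen--Macaulay. For $\alpha\in\mathbb R^n$, $V_I(\mathbb R)$ near $\alpha$ is a translate of the real coordinate subspace arrangement given by $\mathrm{E}\Delta_\alpha$, and $V_I(\mathbb R)$ is Cohen--Macaulay over $\Bbbk$ near $\alpha$ when $\mathrm{E}\Delta_\alpha$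 is Cohen--Macaulay over $\Bbbk$; $V_I(\mathbb R)$ is Cohen--Macaulay over $\Bbbk$ when this holds at every point $\alpha\in\mathbb R^n$.
   Formalization: ''V_I(R) is Cohen–Macaulay'' here also requires all exponent complexes at points of V_I(R) to have one common dimension; without this the first equivalence fails, e.g. I=(x²,xy). In the second, α ranges over V_I, which must be nonempty. *)

(* Defs.v *)
From HB Require Import structures.
From mathcomp Require Import all_boot all_order all_algebra generic_quotient.
From mathcomp Require Import boolp classical_sets reals complex mpoly.

Set Implicit Arguments.
Unset Strict Implicit.
Unset Printing Implicit Defensive.

Import GRing.Theory.
Local Open Scope classical_set_scope.
Local Open Scope quotient_scope.
Local Open Scope ring_scope.

(* Unlike [idealr] of ring_quotient, the unit ideal is allowed. *)
Definition is_ideal (R : comPzRingType) (J : set R) : Prop :=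
  [/\ J 0, forall x y, J x -> J y -> J (x + y) & forall a x, J x -> J (a * x)].

Definition ideal_gen (R : comPzRingType) (G : set R) : set R :=
  [set x | forall J : set R, is_ideal J -> G `<=` J -> J x].

Lemma ideal_genP (R : comPzRingType) (G : set R) : is_ideal (ideal_gen G).
Proof.
split=> [J [] //|x y Gx Gy J iJ GJ|a x Gx J iJ GJ]; case: (iJ) => _ JD JM.
  by apply: JD; [apply: Gx | apply: Gy].
by apply: JM; apply: Gx.
Qed.

Section QuotientRing.
Variables (R : comPzRingType) (G : set R).

Definition qring_rel (x y : R) : bool := `[< ideal_gen G (x - y) >].

Let gen0 : ideal_gen G 0. Proof. by case: (ideal_genP G). Qed.
Let genD x y : ideal_gen G x -> ideal_gen G y -> ideal_gen G (x + y).
Proof. by case: (ideal_genP G) => _ + _; apply. Qed.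
Let genM a x : ideal_gen G x -> ideal_gen G (a * x).
Proof. by case: (ideal_genP G) => _ _; apply. Qed.
Let genN x : ideal_gen G x -> ideal_gen G (- x).
Proof. by rewrite -mulN1r; apply: genM. Qed.

Lemma qring_rel_equiv : equiv_class_of qring_rel.
Proof.
split=> [x|x y|y x z].
- by apply/asboolP; rewrite subrr.
- by apply/asboolP/asboolP => /genN; rewrite opprB.
- move=> /asboolP xy /asboolP yz; apply/asboolP.
  by rewrite -(subrK y x) -addrA; apply: genD.
Qed.

Canonical qring_equiv := EquivRelPack qring_rel_equiv.
Canonical qring_encModRel := defaultEncModRel qring_rel.

(* R/(G), the quotient of R by the ideal generated by G; it is a [comPzRingType]
   since it is the zero ring when G generates the unit ideal. *)
Definition qring := {eq_quot qring_rel}.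
HB.instance Definition _ : EqQuotient R qring_equiv qring :=
  EqQuotient.on qring.
HB.instance Definition _ := Choice.on qring.

Lemma qring_eqP (x y : R) :
  reflect (ideal_gen G (x - y)) (x == y %[mod qring]).
Proof. by rewrite piE; apply: asboolP. Qed.

Definition qring_zero : qring := lift_cst qring 0.
Definition qring_one : qring := lift_cst qring 1.
Definition qring_opp := lift_op1 qring -%R.
Definition qring_add := lift_op2 qring +%R.
Definition qring_mul := lift_op2 qring *%R.

Canonical qring_pi_zero := PiConst qring_zero.
Canonical qring_pi_one := PiConst qring_one.

Lemma qring_piN : {morph \pi_qring : x / - x >-> qring_opp x}.
Proof.
move=> x; unlock qring_opp; apply/eqP/qring_eqP.
rewrite -opprD; apply: genN; apply/qring_eqP.
by rewrite reprK.
Qed.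
Canonical qring_pi_opp := PiMorph1 qring_piN.

Lemma qring_piD : {morph \pi_qring : x y / x + y >-> qring_add x y}.
Proof.
move=> x y; unlock qring_add; apply/eqP/qring_eqP.
rewrite opprD addrACA; apply: genD; apply/qring_eqP; by rewrite reprK.
Qed.
Canonical qring_pi_add := PiMorph2 qring_piD.

Lemma qring_piM : {morph \pi_qring : x y / x * y >-> qring_mul x y}.
Proof.
move=> x y; unlock qring_mul; apply/eqP/qring_eqP.
rewrite -(subrKA (x * repr (\pi_qring y))) -mulrBr -mulrBl.
apply: genD; first by apply: genM; apply/qring_eqP; rewrite reprK.
by rewrite mulrC; apply: genM; apply/qring_eqP; rewrite reprK.
Qed.
Canonical qring_pi_mul := PiMorph2 qring_piM.

Lemma qring_addA : associative qring_add.
Proof.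
by move=> x y z; rewrite -[x]reprK -[y]reprK -[z]reprK !piE addrA.
Qed.
Lemma qring_addC : commutative qring_add.
Proof. by move=> x y; rewrite -[x]reprK -[y]reprK !piE addrC. Qed.
Lemma qring_add0 : left_id qring_zero qring_add.
Proof. by move=> x; rewrite -[x]reprK !piE add0r. Qed.
Lemma qring_addN : left_inverse qring_zero qring_opp qring_add.
Proof. by move=> x; rewrite -[x]reprK !piE addNr. Qed.

HB.instance Definition _ :=
  GRing.isZmodule.Build qring qring_addA qring_addC qring_add0 qring_addN.

Lemma qring_mulA : associative qring_mul.
Proof.
by move=> x y z; rewrite -[x]reprK -[y]reprK -[z]reprK !piE mulrA.
Qed.
Lemma qring_mulC : commutative qring_mul.
Proof. by move=> x y; rewrite -[x]reprK -[y]reprK !piE mulrC. Qed.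
Lemma qring_mul1 : left_id qring_one qring_mul.
Proof. by move=> x; rewrite -[x]reprK !piE mul1r. Qed.
Lemma qring_mulD : left_distributive qring_mul +%R.
Proof.
move=> x y z; rewrite -[x]reprK -[y]reprK -[z]reprK.
by rewrite /GRing.add/= !piE mulrDl.
Qed.

HB.instance Definition _ := GRing.Zmodule_isComPzRing.Build qring
  qring_mulA qring_mulC qring_mul1 qring_mulD.

Lemma qring_pi_is_zmod_morphism : zmod_morphism (\pi_qring : R -> qring).
Proof.
by move=> x y; rewrite qring_piD qring_piN.
Qed.
Lemma qring_pi_is_monoid_morphism : monoid_morphism (\pi_qring : R -> qring).
Proof.
split; first by rewrite piE.
by move=> x y; rewrite qring_piM.
Qed.
HB.instance Definition _ :=
  GRing.isZmodMorphism.Build R qring \pi_qring qring_pi_is_zmod_morphism.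
HB.instance Definition _ :=
  GRing.isMonoidMorphism.Build R qring \pi_qring qring_pi_is_monoid_morphism.

End QuotientRing.

Section CohenMacaulay.
Variable R : comPzRingType.

Definition prime_ideal (P : set R) : Prop :=
  [/\ is_ideal P, ~ P 1 & forall x y, P (x * y) -> P x \/ P y].

Definition maximal_ideal (P : set R) : Prop :=
  [/\ is_ideal P, ~ P 1 &
      forall J : set R, is_ideal J -> ~ J 1 -> P `<=` J -> J = P].

(* P 0 < P 1 < ... < P l; the values of P beyond l are irrelevant. *)
Definition prime_chain (l : nat) (P : nat -> set R) : Prop :=
  (forall i, (i <= l)%N -> prime_ideal (P i)) /\
  (forall i, (i < l)%N -> P i `<` P i.+1).

(* No d satisfies this when R is the zero ring. *)
Definition has_krull_dim (d : nat) : Prop :=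
  (exists P, prime_chain d P) /\
  (forall l P, prime_chain l P -> (l <= d)%N).

Definition has_codim (Q : set R) (c : nat) : Prop :=
  (exists2 P, prime_chain c P & P c = Q) /\
  (forall l P, prime_chain l P -> P l = Q -> (l <= c)%N).

Definition regular_seq (s : seq R) : Prop :=
  ~ ideal_gen [set` s] 1 /\
  forall i, (i < size s)%N -> forall y,
    ideal_gen [set` take i s] (s`_i * y) -> ideal_gen [set` take i s] y.

Definition has_depth (Q : set R) (r : nat) : Prop :=
  (exists s, [/\ regular_seq s, [set` s] `<=` Q & size s = r]) /\
  (forall s, regular_seq s -> [set` s] `<=` Q -> (size s <= r)%N).

(* Eisenbud's definition of a Cohen-Macaulay ring (Commutative Algebra, 18.2),
   for Noetherian R: depth Q = codim Q for all maximal ideals Q.  It is applied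
   below to quotients of polynomial rings over fields only.  The zero ring is
   Cohen-Macaulay. *)
Definition cohen_macaulay : Prop :=
  forall Q, maximal_ideal Q -> exists2 c, has_codim Q c & has_depth Q c.

End CohenMacaulay.

Section StanleyReisner.
Variables (k : fieldType) (n : nat).

Definition stanley_reisner (D : {set {set 'I_n}}) : comPzRingType :=
  qring [set (\prod_(i in F) 'X_i : {mpoly k[n]})
        | F in [set F : {set 'I_n} | F \notin D]].

(* The void complex (without even the empty face) has Stanley-Reisner ring 0 and
   is thus Cohen-Macaulay; it has no dimension in the sense of [cx_has_dim]. *)
Definition cx_cohen_macaulay (D : {set {set 'I_n}}) : Prop :=
  cohen_macaulay (stanley_reisner D).

End StanleyReisner.

Definition cx_has_dim (n : nat) (D : {set {set 'I_n}}) (e : int) : Prop :=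
  (exists2 F, F \in D & #|F|%:Z - 1 = e) /\
  (forall F, F \in D -> #|F|%:Z - 1 <= e).

Section Zariski.
Variables (C : fieldType) (n : nat).
Implicit Types A V Z : set 'rV[C]_n.

Definition zariski_closed Z : Prop :=
  exists E : set {mpoly C[n]}, Z = [set v | forall p, E p -> p.@[v 0] = 0].

Definition zariski_closure A : set 'rV[C]_n :=
  [set v | forall Z, zariski_closed Z -> A `<=` Z -> Z v].

Definition zariski_irreducible A : Prop :=
  A !=set0 /\
  forall Z1 Z2, zariski_closed Z1 -> zariski_closed Z2 ->
    A `<=` Z1 `|` Z2 -> A `<=` Z1 \/ A `<=` Z2.

Definition irreducible_component V A : Prop :=
  [/\ A `<=` V, zariski_irreducible A &
      forall B, zariski_irreducible B -> A `<=` B -> B `<=` V -> B = A].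

Definition components_through V (a : 'rV[C]_n) : set 'rV[C]_n :=
  \bigcup_(A in [set A | irreducible_component V A /\ A a]) A.

Definition coord_subspace (F : {set 'I_n}) : set 'rV[C]_n :=
  [set v | forall i, i \notin F -> v 0 i = 0].

Definition exponent_complex V (a : 'rV[C]_n) : {set {set 'I_n}} :=
  [set F : {set 'I_n} | `[< coord_subspace F `<=`
     [set z - a | z in components_through V a] >]]%SET.

End Zariski.

Section Distracting.
Variables (R : realType) (k : fieldType) (n : nat).

Definition monomial_ideal (I : set {mpoly k[n]}) : Prop :=
  exists M : set 'X_{1..n}, I = ideal_gen [set 'X_[m] | m in M].

Definition exponent_points (I : set {mpoly k[n]}) : set 'rV[R[i]]_n :=
  [set \row_i (m i)%:R | m in [set m : 'X_{1..n} | ~ I 'X_[m]]].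

Definition distracting (I : set {mpoly k[n]}) : set 'rV[R[i]]_n :=
  zariski_closure (exponent_points I).

Definition complex_point (a : 'rV[R]_n) : 'rV[R[i]]_n :=
  map_mx (real_complex R) a.

Definition real_points (V : set 'rV[R[i]]_n) : set 'rV[R]_n :=
  complex_point @^-1` V.

Definition real_cm_near (V : set 'rV[R[i]]_n) (a : 'rV[R]_n) : Prop :=
  cx_cohen_macaulay k (exponent_complex V (complex_point a)).

(* Cohen-Macaulay spaces are equidimensional, and the condition at each point
   does not relate the dimensions at distinct points: for I = (x^2, xy) the
   arrangement is the disjoint union of a line and a point, so the condition
   holds at every point although S/I is not Cohen-Macaulay.  Equidimensionality
   is therefore part of the definition.  The void complexes at the points
   outside the arrangement are not concerned. *)
Definition real_arrangement_cm (V : set 'rV[R[i]]_n) : Prop :=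
  (forall a, real_cm_near V a) /\
  exists e : int, forall a, real_points V a ->
    cx_has_dim (exponent_complex V (complex_point a)) e.

End Distracting.

Arguments distracting R {k n} I.

(* Main.v *)
(* Let N exceed all the exponents of the minimal generators of I.  The ring S is
   free over its subring k[x_1^N, ..., x_n^N], with the monomials x^b such that
   all b_i < N as a basis, and I splits along this basis: as a module over
   k[x_1^N, ..., x_n^N], identified with S, the quotient S/I is the direct sum of
   the Stanley-Reisner rings of the exponent complexes at the lattice points b,
   and every exponent complex occurs among these.

   If D is the largest dimension, then the elementary symmetric polynomials of
   degrees 1, ..., D in the x_i^N form a homogeneous system of parameters of S/I,
   and those in the x_i one of each Stanley-Reisner ring of dimension D.  So it
   suffices to show that the quotient of S by a monomial ideal is Cohen-Macaulay
   if and only if this system of parameters is a regular sequence, since the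
   latter condition can be checked on each direct summand.

   If the depth at the ideal of the variables is D, then the Koszul homology of the
   parameters vanishes in positive degrees, hence they form a regular sequence by
   the graded Nakayama lemma.  Conversely let Q be a maximal ideal.  By Zariski's
   lemma each parameter t is a root modulo Q of a monic polynomial p; the p(t)
   form a regular sequence in Q because their leading forms, which are powers of
   the parameters, do.  A regular sequence in Q yields a chain of primes of the
   same length ending at Q, and the chains of primes of S/I have length at most D. *)

From HB Require Import structures.
From mathcomp Require Import all_boot all_order all_algebra generic_quotient.
From mathcomp Require Import boolp classical_sets reals complex ssrcomplements.
From mathcomp Require Import mpoly zify ring.
Require Import Defs.
Set Implicit Arguments.
Unset Strict Implicit.
Unset Printing Implicit Defensive.
Import GRing.Theory Num.Theory.
Local Open Scope classical_set_scope.
Local Open Scope ring_scope.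

(** * Regular sequences modulo an ideal *)

Section Adjunction.
Variable S : comPzRingType.
Implicit Types (J : set S) (a x y : S) (s t : seq S).

Lemma ideal0 J : is_ideal J -> J 0. Proof. by case. Qed.

Lemma idealD J x y : is_ideal J -> J x -> J y -> J (x + y).
Proof. by case=> _ + _; apply. Qed.

Lemma idealM J a x : is_ideal J -> J x -> J (a * x).
Proof. by case=> _ _; apply. Qed.

Lemma idealMr J a x : is_ideal J -> J x -> J (x * a).
Proof. by rewrite mulrC; apply: idealM. Qed.

Lemma idealN J x : is_ideal J -> J x -> J (- x).
Proof. by move=> iJ Jx; rewrite -mulN1r; apply: idealM. Qed.

Lemma idealB J x y : is_ideal J -> J x -> J y -> J (x - y).
Proof. by move=> iJ Jx Jy; apply: idealD => //; apply: idealN. Qed.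

Lemma idealBl J x y : is_ideal J -> J (x - y) -> J y -> J x.
Proof. by move=> iJ Jxy Jy; rewrite -(subrK y x); apply: idealD. Qed.

Lemma idealBr J x y : is_ideal J -> J (x - y) -> J x -> J y.
Proof. by move=> iJ Jxy Jx; rewrite -(subKr x y); apply: idealB. Qed.

Lemma ideal_sum J (I : Type) (r : seq I) (P : pred I) (F : I -> S) :
  is_ideal J -> (forall i, P i -> J (F i)) -> J (\sum_(i <- r | P i) F i).
Proof.
move=> iJ JF; apply: (big_ind J) => //; first exact: ideal0.
by move=> x y; apply: idealD.
Qed.

(** For an ideal [J] this is [J + (a)], and [idl J s] is [J + (s)]; working in [S] relative to an
    ideal avoids iterated quotient rings. *)
Definition adj J a : set S := [set x | exists c, J (x - c * a)].

Definition idl J s : set S := foldl adj J s.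

(** Weak regularity: the quotient by [J + (s)] may be zero. In this form the notion passes to direct
    summands, some of which can vanish. *)
Fixpoint wreg J s : Prop :=
  if s is a :: s' then (forall y, J (a * y) -> J y) /\ wreg (adj J a) s'
  else True.

Lemma adj_ideal J a : is_ideal J -> is_ideal (adj J a).
Proof.
move=> iJ; split.
- by exists 0; rewrite mul0r subr0; apply: ideal0.
- move=> x y [c Jc] [d Jd]; exists (c + d).
  by rewrite mulrDl opprD addrACA; apply: idealD.
- move=> b x [c Jc]; exists (b * c).
  by rewrite -mulrA -mulrBr; apply: idealM.
Qed.

Lemma sub_adj J a : is_ideal J -> J `<=` adj J a.
Proof. by move=> iJ x Jx; exists 0; rewrite mul0r subr0. Qed.

Lemma adj_self J a : is_ideal J -> adj J a a.
Proof. by move=> iJ; exists 1; rewrite mul1r subrr; apply: ideal0. Qed.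

Lemma adj_min J a K : is_ideal K -> J `<=` K -> K a -> adj J a `<=` K.
Proof.
move=> iK JK Ka x [c Jc]; apply: (idealBl iK) (idealM c iK Ka).
exact: JK.
Qed.

Lemma idl_ideal J s : is_ideal J -> is_ideal (idl J s).
Proof.
by elim: s J => // a s IHs J iJ; apply: IHs; apply: adj_ideal.
Qed.

Lemma sub_idl J s : is_ideal J -> J `<=` idl J s.
Proof.
elim: s J => [|a s IHs] J iJ x Jx //=.
by apply: IHs; [apply: adj_ideal | apply: sub_adj].
Qed.

Lemma mem_idl J s a : is_ideal J -> a \in s -> idl J s a.
Proof.
elim: s J => // b s IHs J iJ; rewrite inE => /predU1P[->|sa].
  by apply: sub_idl (adj_self _ iJ); apply: adj_ideal.
by apply: IHs => //; apply: adj_ideal.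
Qed.

Lemma idl_min J s K :
  is_ideal K -> J `<=` K -> {in s, forall a, K a} -> idl J s `<=` K.
Proof.
move=> iK; elim: s J => [|a s IHs] J JK Ks //=; apply: IHs.
  by apply: adj_min => //; apply: Ks; rewrite mem_head.
by move=> b sb; apply: Ks; rewrite inE sb orbT.
Qed.

Lemma idl_mono J K s : is_ideal K -> J `<=` K -> idl J s `<=` idl K s.
Proof.
move=> iK JK; apply: idl_min; first exact: idl_ideal.
  by apply: subset_trans JK _; apply: sub_idl.
by move=> a; apply: mem_idl.
Qed.

Lemma eq_idl J s t : is_ideal J -> s =i t -> idl J s = idl J t.
Proof.
move=> iJ st; apply/seteqP; split; apply: idl_min; try exact: idl_ideal;
  try exact: sub_idl.
- by move=> a; rewrite st; apply: mem_idl.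
- by move=> a; rewrite -st; apply: mem_idl.
Qed.

Lemma idl_rcons J s a : idl J (rcons s a) = adj (idl J s) a.
Proof. by rewrite /idl -cats1 foldl_cat. Qed.

Lemma wreg_rcons J s a :
  wreg J (rcons s a) <-> wreg J s /\ (forall y, idl J s (a * y) -> idl J s y).
Proof.
elim: s J => [|b s IHs] J /=; first by split=> [[]|[]].
split=> [[rb /IHs[rs ra]]|[[rb rs] ra]]; first by [].
by split=> //; apply/IHs.
Qed.

Lemma wreg_take J s i : wreg J s -> wreg J (take i s).
Proof.
by elim: s i J => //= a s IHs [|i] J //= [ra rs]; split=> //; apply: IHs.
Qed.

Lemma wreg_nth J s i : wreg J s -> (i < size s)%N ->
  forall y, idl J (take i s) (s`_i * y) -> idl J (take i s) y.
Proof.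
elim: s i J => //= a s IHs [|i] J [ra rs] si; first exact: ra.
exact: IHs rs si.
Qed.

Lemma nth_wreg J s :
  (forall i, (i < size s)%N ->
     forall y, idl J (take i s) (s`_i * y) -> idl J (take i s) y) ->
  wreg J s.
Proof.
elim: s J => //= a s IHs J rs; split; first exact: (rs 0%N).
by apply: IHs => i si; apply: (rs i.+1).
Qed.

End Adjunction.

(** * Koszul homology *)

Section Koszul.
Variable S : comPzRingType.
Implicit Types (J : set S) (a x y : S) (s : seq S).

(* The Koszul complex of [a :: s] is the mapping cone of multiplication by [a] on
   that of [s]; all degrees are lumped together, and [kge m] singles out the
   chains whose components have degree at least [m]. *)
Fixpoint kz (t : nat) : lmodType S :=
  if t is t'.+1 then (kz t' * kz t')%type : lmodType S else S^o : lmodType S.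

Fixpoint kd (s : seq S) : kz (size s) -> kz (size s) :=
  match s with
  | [::] => fun _ => 0
  | a :: s' => fun c => (kd (s := s') c.1 + a *: c.2, - kd (s := s') c.2)
  end.

Fixpoint kge (t : nat) (m : nat) : kz t -> Prop :=
  match t with
  | 0 => fun c => m = 0%N \/ c = 0
  | t'.+1 => fun c => kge m c.1 /\ kge m.-1 c.2
  end.

Fixpoint kin J (t : nat) : kz t -> Prop :=
  match t with
  | 0 => fun c => J c
  | t'.+1 => fun c => kin J c.1 /\ kin J c.2
  end.

Lemma kd_linear s : linear (@kd s).
Proof.
elim: s => [|a s IHs] x u v /=; first by rewrite scaler0 addr0.
have kdN (w w' : kz (size s)) :
  kd (x *: w + w') = x *: kd w + kd w' by apply: IHs.
rewrite !kdN; congr pair.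
  rewrite /= !scalerDr addrACA; congr (_ + (_ + _)).
  by rewrite !scalerA mulrC.
by rewrite /= opprD scalerN.
Qed.

HB.instance Definition _ s := GRing.isLinear.Build S (kz (size s))
  (kz (size s)) _ (@kd s) (@kd_linear s).

Lemma kdD s : {morph @kd s : c d / c + d}. Proof. exact: linearD. Qed.
Lemma kdB s : {morph @kd s : c d / c - d}. Proof. exact: linearB. Qed.
Lemma kdN s : {morph @kd s : c / - c}. Proof. exact: linearN. Qed.
Lemma kdZ s a : {morph @kd s : c / a *: c}. Proof. exact: linearZ. Qed.
Lemma kd0 s : @kd s 0 = 0. Proof. exact: linear0. Qed.

Lemma kd_kd s (c : kz (size s)) : kd (kd c) = 0.
Proof.
elim: s c => [|a s IHs] c //=.
by rewrite kdD IHs kdZ kdN IHs add0r scalerN subrr !oppr0.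
Qed.

Lemma kge0 t m : kge m (0 : kz t).
Proof. by elim: t m => [|t IHt] m /=; [right | split; apply: IHt]. Qed.

Lemma kge_0 t (c : kz t) : kge 0 c.
Proof. by elim: t c => [|t IHt] c /=; [left | split; apply: IHt]. Qed.

Lemma kgeD t m (c d : kz t) : kge m c -> kge m d -> kge m (c + d).
Proof.
elim: t m c d => [|t IHt] m c d /=.
  by case=> [->|->]; [left | rewrite add0r].
by move=> [? ?] [? ?]; split; apply: IHt.
Qed.

Lemma kgeZ t m a (c : kz t) : kge m c -> kge m (a *: c).
Proof.
elim: t m c => [|t IHt] m c /=.
  by case=> [->|->]; [left | right; rewrite scaler0].
by move=> [? ?]; split; apply: IHt.
Qed.

Lemma kgeN t m (c : kz t) : kge m c -> kge m (- c).
Proof. by rewrite -scaleN1r; apply: kgeZ. Qed.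

Lemma kgeB t m (c d : kz t) : kge m c -> kge m d -> kge m (c - d).
Proof. by move=> ? ?; apply: kgeD => //; apply: kgeN. Qed.

Lemma kge_gt t m (c : kz t) : (t < m)%N -> kge m c -> c = 0.
Proof.
elim: t m c => [|t IHt] m c /=; first by move=> m0 [m1|//]; rewrite m1 in m0.
case: c => u v /= tm [/IHt hu /IHt hv]; rewrite hu ?hv //.
  by case: m tm {hu hv}.
exact: ltnW.
Qed.

Lemma kge_kd s m (c : kz (size s)) : kge m c -> kge m.-1 (kd c).
Proof.
elim: s m c => [|a s IHs] m c /=; first by move=> _; right.
move=> [h1 h2]; split; last by apply: kgeN; apply: IHs.
by apply: kgeD; [apply: IHs | apply: kgeZ].
Qed.

Lemma kin_sub J (K : set S) t (c : kz t) : J `<=` K -> kin J c -> kin K c.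
Proof.
by move=> JK; elim: t c => [|t IHt] c /=; [apply: JK | case=> /IHt ? /IHt].
Qed.

Section Ideal.
Variables (J : set S) (iJ : is_ideal J).

Lemma kin0 t : kin J (0 : kz t).
Proof. by elim: t => [|t IHt] /=; [apply: ideal0 | split]. Qed.

Lemma kinD t (c d : kz t) : kin J c -> kin J d -> kin J (c + d).
Proof.
elim: t c d => [|t IHt] c d /=; first exact: idealD.
by move=> [? ?] [? ?]; split; apply: IHt.
Qed.

Lemma kinZ t a (c : kz t) : kin J c -> kin J (a *: c).
Proof.
elim: t c => [|t IHt] c /=; first exact: idealM.
by move=> [? ?]; split; apply: IHt.
Qed.

Lemma kinN t (c : kz t) : kin J c -> kin J (- c).
Proof. by rewrite -scaleN1r; apply: kinZ. Qed.

Lemma kinBl t (c d : kz t) : kin J (c - d) -> kin J d -> kin J c.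
Proof. by move=> ? ?; rewrite -(subrK d c); apply: kinD. Qed.

Lemma kinZl t a (c : kz t) : J a -> kin J (a *: c).
Proof.
move=> Ja; elim: t c => [|t IHt] c /=; first exact: idealMr.
by split; apply: IHt.
Qed.

Lemma kin_kd s (c : kz (size s)) : kin J c -> kin J (kd c).
Proof.
elim: s c => [|a s IHs] c /=; first by move=> _; apply: ideal0.
move=> [h1 h2]; split; last by apply: kinN; apply: IHs.
by apply: kinD; [apply: IHs | apply: kinZ].
Qed.

Lemma kin_cancel t a (c : kz t) :
  (forall y, J (a * y) -> J y) -> kin J (a *: c) -> kin J c.
Proof.
move=> ra; elim: t c => [|t IHt] c /=; first exact: ra.
by move=> [? ?]; split; apply: IHt.
Qed.

Lemma kin_adj t a m (c : kz t) : kge m c -> kin (adj J a) c ->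
  exists2 y, kge m y & kin J (c - a *: y).
Proof.
elim: t m c => [|t IHt] m c /=.
  case=> [->|->] => [[d Jd]|_]; first by exists d; [left | move: Jd; rewrite mulrC].
  by exists 0; [right | rewrite scaler0 subr0; apply: ideal0].
move=> [h1 h2] [/(IHt _ _ h1)[y1 k1 J1] /(IHt _ _ h2)[y2 k2 J2]].
by exists (y1, y2).
Qed.

End Ideal.

(* Vanishing of the Koszul homology of S/J on s in degrees at least m. *)
Definition kacyclic J s m := forall c : kz (size s),
  kge m c -> kin J (kd c) -> exists2 b, kge m.+1 b & kin J (c - kd b).

(** Multiplication by an entry of [s] is null-homotopic: in the cone of that entry the homotopy
    sends the target copy to the source copy; the homotopies of later entries extend with a sign on
    the second component. *)
Lemma kd_homotopy s a : a \in s ->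
  exists h : kz (size s) -> kz (size s),
    [/\ forall x c d, h (x *: c + d) = x *: h c + h d,
        forall m c, kge m c -> kge m.+1 (h c),
        forall J, is_ideal J -> forall c, kin J c -> kin J (h c) &
        forall c, kd (h c) + h (kd c) = a *: c].
Proof.
elim: s => // b s IHs; rewrite inE => /predU1P[->|/IHs[h [hL hge hin hE]]].
  exists (fun c => (0, c.1)); split.
  - move=> x [u v] [u' v'] /=; by congr pair; rewrite /= scaler0 addr0.
  - by move=> m [u v] /= [ku _]; split=> //; apply: kge0.
  - by move=> J iJ [u v] /= [Ju _]; split=> //; apply: kin0.
  - move=> [u v] /=; rewrite kd0 add0r; congr pair; rewrite /= ?addr0 //.
    by rewrite addKr.
have h0 : h 0 = 0.
  by have /eqP := hL 1 0 0; rewrite !scale1r addr0 -subr_eq subrr eq_sym => /eqP.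
have hD w w' : h (w + w') = h w + h w' by rewrite -[w]scale1r hL !scale1r.
have hZ x w : h (x *: w) = x *: h w by rewrite -[x *: w]addr0 hL h0 addr0.
have hN w : h (- w) = - h w by rewrite -scaleN1r hZ scaleN1r.
exists (fun c => (h c.1, - h c.2)); split.
- move=> x [u v] [u' v'] /=; by congr pair; rewrite /= hD hZ // opprD scalerN.
- move=> m [u v] /= [ku kv]; split; first exact: hge.
  apply: kgeN; case: m ku kv => [|m] ku kv; first exact: kge_0.
  exact: hge.
- move=> J iJ [u v] /= [Ju Jv]; split; first exact: hin.
  by apply: kinN => //; apply: hin.
- move=> [u v] /=; rewrite kdN hD hZ hN !opprK scalerN; congr pair => /=.
    by rewrite -hE addrACA addNr addr0.
  by rewrite -hE.
Qed.

(** By the homotopies, the multipliers that turn the cycle [c] into a boundary modulo [J] form an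
    ideal containing [J] and [s]. *)
Lemma kacyclic_annihil J s m x (c : kz (size s)) : is_ideal J ->
  idl J s x -> kge m c -> kin J (kd c) ->
  exists2 b, kge m.+1 b & kin J (x *: c - kd b).
Proof.
move=> iJ sx mc Jc.
pose K := [set y | exists2 b, kge m.+1 b & kin J (y *: c - kd b)].
suff: idl J s `<=` K by apply.
apply: idl_min => [|y Jy|a sa].
- split=> [|y z [b1 k1 J1] [b2 k2 J2]|a y [b kb Jb]].
  + by exists 0; [apply: kge0 | rewrite scale0r kd0 subr0; apply: kin0].
  + exists (b1 + b2); first exact: kgeD.
    by rewrite kdD scalerDl opprD addrACA; apply: kinD.
  + exists (a *: b); first exact: kgeZ.
    by rewrite kdZ -scalerA -scalerBr; apply: kinZ.
- by exists 0; [apply: kge0 | rewrite kd0 subr0; apply: kinZl].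
- have [h [_ hge hin hE]] := kd_homotopy sa.
  exists (h c); first exact: hge.
  by rewrite -hE addrC addKr; apply: hin.
Qed.

(* Depth sensitivity of the Koszul complex *)
Lemma wreg_kacyclic J s t m : is_ideal J ->
  wreg J t -> {in t, forall a, exists N, idl J s (a ^+ N)} ->
  (size s < m + size t)%N -> kacyclic J s m.
Proof.
elim: t J m => [|a t IHt] J m iJ /=.
  rewrite addn0 => _ _ sm c /(kge_gt sm) -> _.
  by exists 0; [apply: kge0 | rewrite kd0 subr0; apply: kin0].
move=> [ra rt] radt sm c mc Jc.
have iJa := adj_ideal a iJ.
(* Modulo [a] one regular element is lost, and the degree from which homology vanishes rises by
   one. *)
have acyc : kacyclic (adj J a) s m.+1.
  apply: IHt => //; last by rewrite addSnnS.
  move=> b tb; have [|N sN] := radt b; first by rewrite inE tb orbT.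
  by exists N; apply: idl_mono sN => //; apply: sub_adj.
have [|N sN] := radt a; first exact: mem_head.
have [b mb Jb] : exists2 b, kge m.+1 b & kin J (a ^+ N *: c - kd b).
  exact: kacyclic_annihil.
(* Descent on the power of [a]: if [a ^+ N.+1 *: c] is the boundary of [b], then [b] is a cycle
   modulo [a], hence [a *: y] up to a boundary, and cancelling [a] makes [a ^+ N *: c] the boundary
   of [y]. *)
elim: N {sN} b mb Jb => [|N IHN] b mb Jb.
  by exists b; rewrite // -[c]scale1r.
have [|e me Je] := acyc b mb.
  apply: (kinBl iJa (d := a ^+ N.+1 *: c)); last first.
    by apply: kinZl => //; exists (a ^+ N); rewrite -exprSr subrr; apply: ideal0.
  rewrite -opprB; apply: kinN => //.
  by apply: kin_sub Jb; apply: sub_adj.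
have kbe : kge m.+1 (b - kd e) by apply: kgeB => //; exact: kge_kd me.
have [y my Jy] := kin_adj iJ kbe Je.
apply: (IHN y my); apply: (kin_cancel ra).
rewrite scalerBr scalerA -exprS -kdZ.
have := kin_kd iJ Jy; rewrite !kdB kd_kd subr0 => Jby.
by have := kinD iJ Jb Jby; rewrite addrA subrK.
Qed.

Fixpoint kz_in (t : nat) (x : S) : kz t :=
  if t is t'.+1 then (kz_in t' x, 0) else x.

Fixpoint kz_out (t : nat) : kz t -> S :=
  if t is t'.+1 then fun c => kz_out c.1 else id.

Lemma kz_outD t : {morph @kz_out t : c d / c + d}.
Proof. by elim: t => //= t IHt c d; apply: IHt. Qed.

Lemma kz_outZ t a (c : kz t) : kz_out (a *: c) = a * kz_out c.
Proof. by elim: t c => //= t IHt c; apply: IHt. Qed.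

Lemma kz_outN t (c : kz t) : kz_out (- c) = - kz_out c.
Proof. by rewrite -scaleN1r kz_outZ mulN1r. Qed.

Lemma kz_inK t : cancel (@kz_in t) (@kz_out t).
Proof. by elim: t => //= t IHt x; apply: IHt. Qed.

Lemma kz_inZ t a x : kz_in t (a * x) = a *: kz_in t x.
Proof. by elim: t => //= t ->; congr pair; rewrite /= scaler0. Qed.

Lemma kd_kz_in s x : kd (kz_in (size s) x) = 0.
Proof.
elim: s => //= a s ->; rewrite scaler0 addr0.
by congr pair; rewrite kd0 oppr0.
Qed.

Lemma kin_out J t (c : kz t) : kin J c -> J (kz_out c).
Proof. by elim: t c => //= t IHt c [/IHt]. Qed.

(** The Koszul homology in degree zero is the quotient by [J + (s)]. *)
Lemma idl_kz_in J s x : is_ideal J ->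
  idl J s x <-> exists2 b, kge 1 b & kin J (kz_in (size s) x - kd b).
Proof.
move=> iJ; split=> [sx|[b _ Jb]].
  have [||b kb Jb] := kacyclic_annihil iJ sx (m := 0) (c := kz_in (size s) 1).
  - exact: kge_0.
  - by rewrite kd_kz_in; apply: kin0.
  - by exists b; rewrite // -[x]mulr1 kz_inZ.
have out_kd (c : kz (size s)) : idl J s (kz_out (kd c)).
  elim: s J iJ {b Jb} c => [|a s IHs] J iJ c /=; first exact: ideal0.
  have iJa := adj_ideal a iJ.
  rewrite kz_outD kz_outZ; apply: idealD; first exact: idl_ideal.
    by apply: idl_mono (IHs J iJ _) => //; apply: sub_adj.
  apply: sub_idl => //; apply: idealMr => //; exact: adj_self.
apply: idealBl (out_kd b); first exact: idl_ideal.
apply: sub_idl => //; have := kin_out Jb.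
by rewrite kz_outD kz_outN kz_inK.
Qed.

End Koszul.

(** * Graded Nakayama lemma for Koszul homology *)

Section Truncation.
Variables (S : comPzRingType) (J : set S) (iJ : is_ideal J).
(* [tr E] stands for the projection onto the components of degree less than [E];
   no more is needed of a grading. *)
Variable tr : nat -> S -> S.
Hypothesis trD : forall E, {morph tr E : x y / x + y}.
Hypothesis tr_eq0 : forall x, tr 0 x = 0.
Hypothesis trJ : forall E x, J x -> J (tr E x).
Hypothesis tr_id : forall x, exists E0, forall E, (E0 <= E)%N -> tr E x = x.

(** Homogeneity of positive degree [e], seen through truncation. The subtraction stops at 0,
    consistently with the vanishing of [tr 0]. *)
Definition tr_homog (a : S) (e : nat) : Prop :=
  (0 < e)%N /\ forall E x, tr E (a * x) = a * tr (E - e) x.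

Let tr0 E : tr E 0 = 0.
Proof. by apply: (addIr (tr E 0)); rewrite -trD addr0 add0r. Qed.

Let trN E x : tr E (- x) = - tr E x.
Proof. by apply: (addIr (tr E x)); rewrite -trD !addNr tr0. Qed.

(** The cutoff on the second component is lowered by the degree of [a], so that truncation commutes
    with [kd]. *)
Fixpoint ktr (dg : S -> nat) (s : seq S) (E : nat) :
    kz S (size s) -> kz S (size s) :=
  match s with
  | [::] => fun c => tr E c
  | a :: s' => fun c => (@ktr dg s' E c.1, @ktr dg s' (E - dg a) c.2)
  end.

Section Ktr.
Variables (dg : S -> nat) (s : seq S).
Hypothesis dgP : {in s, forall a, tr_homog a (dg a)}.

Lemma ktrD E : {morph @ktr dg s E : c d / c + d}.
Proof.
elim: s E => [|a s' IHs] E c d /=; first exact: trD.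
by rewrite !IHs.
Qed.

Lemma ktr0 E : @ktr dg s E 0 = 0.
Proof. by apply: (addIr (ktr dg E 0)); rewrite -ktrD addr0 add0r. Qed.

Lemma ktrN E : {morph @ktr dg s E : c / - c}.
Proof. by move=> c; apply: (addIr (ktr dg E c)); rewrite -ktrD !addNr ktr0. Qed.

Lemma ktr_eq0 c : @ktr dg s 0 c = 0.
Proof. by elim: s c => [|a s' IHs] c /=; rewrite ?tr_eq0 // sub0n !IHs. Qed.

Lemma ktr_in E c : kin J c -> kin J (@ktr dg s E c).
Proof.
elim: s E c => [|a s' IHs] E c /=; first exact: trJ.
by move=> [? ?]; split; apply: IHs.
Qed.

Lemma ktr_ge E m c : kge m c -> kge m (@ktr dg s E c).
Proof.
elim: s E m c => [|a s' IHs] E m c /=.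
  by case=> [->|->]; [left | right; rewrite tr0].
by move=> [? ?]; split; apply: IHs.
Qed.

Lemma ktr_id c : exists E0, forall E, (E0 <= E)%N -> @ktr dg s E c = c.
Proof.
elim: s c => [|a s' IHs] /=; first exact: tr_id.
move=> [u v]; have [E1 h1] := IHs u; have [E2 h2] := IHs v.
exists (maxn E1 (E2 + dg a)) => E; rewrite geq_max => /andP[h3 h4].
have h5 : (E2 <= E - dg a)%N by lia.
by rewrite (h1 _ h3) (h2 _ h5).
Qed.

Lemma ktrM a e E c : tr_homog a e -> @ktr dg s E (a *: c) = a *: @ktr dg s (E - e) c.
Proof.
move=> [_ ha]; elim: s E c => [|b s' IHs] E c /=; first exact: ha.
by rewrite !IHs subnAC.
Qed.

(** Each factor [a] lowers the cutoff by at least one, until it reaches 0. *)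
Lemma ktrX a e M E c : tr_homog a e -> (E <= M)%N -> @ktr dg s E (a ^+ M *: c) = 0.
Proof.
move=> ha; elim: M E => [|M IHM] E EM.
  by move: EM; rewrite leqn0 => /eqP ->; apply: ktr_eq0.
rewrite exprS -scalerA (ktrM _ _ ha) IHM ?scaler0 //.
by case: (ha) => e0 _; lia.
Qed.

End Ktr.

Lemma ktr_kd dg s E c : {in s, forall a, tr_homog a (dg a)} ->
  @ktr dg s E (kd c) = kd (@ktr dg s E c).
Proof.
elim: s E c => [|a s IHs] E c dgP /=; first exact: tr0.
have dgPs : {in s, forall b, tr_homog b (dg b)}.
  by move=> b sb; apply: dgP; rewrite inE sb orbT.
rewrite ktrD (ktrM _ _ _ (dgP a (mem_head _ _))) ktrN.
by rewrite !IHs.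
Qed.

(* The head of [s] acts surjectively on the homology of its tail in positive
   degrees, which therefore vanishes by the graded Nakayama lemma. *)
Lemma kacyclic_wreg s : {in s, forall a, exists e, tr_homog a e} ->
  kacyclic J s 1 -> wreg J (rev s).
Proof.
move=> hs.
have [dg dgP] : exists dg, {in s, forall a, tr_homog a (dg a)}.
  have /choice[dg dgP] a : exists e, a \in s -> tr_homog a e.
    by have [/hs[e]|] := boolP (a \in s); [exists e | exists 0%N].
  by exists dg => a; apply: dgP.
elim: s dgP {hs} => // a s IHs dgP acyc.
have dgPs : {in s, forall b, tr_homog b (dg b)}.
  by move=> b sb; apply: dgP; rewrite inE sb orbT.
have ha := dgP a (mem_head _ _).
rewrite rev_cons; apply/wreg_rcons; split=> [|y].
  apply: IHs => // c kc Jc.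
  (* Up to boundaries the cycle [c] is a multiple of every power of [a]: [(v, 0)] is a cycle of the
     cone, and a chain bounding it writes [v] as a boundary plus [a *: v']. *)
  have step M : exists b v : kz S (size s), [/\ kge 2 b, kge 1 v, kin J (kd v) &
      kin J (c - (kd b + a ^+ M *: v))].
    elim: M => [|M [b [v [kb kv Jv Jbv]]]].
      exists 0, c; split=> //; first exact: kge0.
      by rewrite kd0 add0r scale1r subrr; apply: kin0.
    have [||[b' v'] /= [kb' kv'] [Jb' Jv']] := acyc (v, 0).
    - by split=> //; apply: kge0.
    - split=> /=; first by rewrite scaler0 addr0.
      by rewrite kd0 oppr0; apply: kin0.
    exists (b + a ^+ M *: b'), v'; split=> //.
    + by apply: kgeD => //; apply: kgeZ.
    + by move: Jv'; rewrite sub0r opprK.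
    + have := kinD iJ Jbv (kinZ iJ (a ^+ M) Jb').
      congr (kin J _); rewrite kdD kdZ scalerBr scalerDr scalerA -exprSr.
      by rewrite !opprD !addrA subrK.
  (* A cutoff that leaves [c] unchanged kills the multiple of [a ^+ E0], so only a boundary
     remains. *)
  have [E0 hE0] := ktr_id dg c.
  have [b [v [kb kv Jv Jbv]]] := step E0.
  exists (ktr dg E0 b); first exact: ktr_ge.
  have := ktr_in dg E0 Jbv.
  by rewrite ktrD ktrN ktrD (ktrX _ _ ha) // addr0 hE0 // ktr_kd.
(* If [a * y] is the boundary of [b], then [(b, - y)] is a cycle of degree one in the cone; the
   second component of a chain bounding it exhibits [y] as a boundary. *)
rewrite (eq_idl iJ (mem_rev s)) => /(idl_kz_in _ _ iJ)[b kb Jb].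
have [||[p q] /= [kp kq] [Jp Jq]] := acyc (b, - kz_in (size s) y).
- by split=> //; apply: kge_0.
- split=> /=; last by rewrite kdN kd_kz_in !oppr0; apply: kin0.
  by rewrite scalerN -kz_inZ -opprB; apply: kinN.
apply/(idl_kz_in _ _ iJ); exists q => //.
by have := kinN iJ Jq; rewrite opprB opprK addrC.
Qed.

End Truncation.

(** * Primes and quotients *)

Section Primes.
Variable S : comPzRingType.
Implicit Types (J P Q T : set S) (a x y : S) (s t : seq S).

Lemma prime_ideal_ideal P : prime_ideal P -> is_ideal P. Proof. by case. Qed.

Lemma prime_ideal_expr P x m : prime_ideal P -> P (x ^+ m) -> P x.
Proof.
move=> [_ P1 PM]; elim: m => [|m IHm]; first by rewrite expr0.
by rewrite exprS => /PM[|/IHm].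
Qed.

Lemma maximal_adj Q x : maximal_ideal Q -> ~ Q x -> adj Q x 1.
Proof.
move=> [iQ Q1 maxQ] Qx; apply: contrapT => n1; apply: Qx.
rewrite -(maxQ (adj Q x)) //; first exact: adj_self.
  exact: adj_ideal.
exact: sub_adj.
Qed.

Lemma maximal_ideal_prime Q : maximal_ideal Q -> prime_ideal Q.
Proof.
move=> mQ; have [iQ Q1 _] := mQ; split=> // x y Qxy.
have [|/(maximal_adj mQ)[c Qc]] := pselect (Q x); [by left | right].
apply: (idealBl iQ (y := c * (x * y))); last exact: idealM.
have -> : y - c * (x * y) = (1 - c * x) * y by ring.
exact: (idealMr _ iQ Qc).
Qed.

(** An ideal maximal among those that contain [J] and miss the multiplicative set [T] is prime. *)
Lemma prime_avoiding J T : is_ideal J -> T 1 ->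
  (forall x y, T x -> T y -> T (x * y)) -> (forall x, J x -> ~ T x) ->
  exists P, [/\ prime_ideal P, J `<=` P & forall x, P x -> ~ T x].
Proof.
move=> iJ T1 TM JT.
pose good A := [/\ is_ideal A, J `<=` A & forall x, A x -> ~ T x].
(* The alternative [A = set0] covers the empty chain, whose union is empty. *)
have [F Fgood Ftot|A [Agood Amax]] := @Zorn_bigcup S (fun A => A = set0 \/ good A).
  have [[A FA A0]|noA] := pselect (exists2 A, F A & A !=set0); last first.
    left; apply/seteqP; split=> // x [A FA Ax]; case: noA; exists A => //.
    by exists x.
  have gF B x : F B -> B x -> good B.
    by move=> /Fgood[->|].
  have gA : good A by case: A0 => x; apply: gF.
  right; split.
  - split.
    + by exists A => //; case: gA => /ideal0.
    + move=> x y [B FB Bx] [C FC Cy].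
      have [BC|CB] := Ftot _ _ FB FC.
        exists C => //; have [iC _ _] := gF _ _ FC Cy.
        by apply: idealD => //; apply: BC.
      exists B => //; have [iB _ _] := gF _ _ FB Bx.
      by apply: idealD => //; apply: CB.
    + move=> a x [B FB Bx]; exists B => //.
      by have [iB _ _] := gF _ _ FB Bx; apply: idealM.
  - by move=> x Jx; exists A => //; case: gA => _ + _; apply.
  - by move=> x [B FB Bx]; have [_ _] := gF _ _ FB Bx; apply.
have gA : good A.
  case: Agood => // A0; exfalso; apply: (Amax J); last first.
    by right; split=> //; apply: subset_refl.
  by rewrite A0; split=> [x //|/(_ 0 (ideal0 iJ))].
have [iA JA AT] := gA.
exists A; split=> //; split=> // [A1|x y Axy]; first exact: AT T1.
have big z : ~ A z -> exists2 c, T c & adj A z c.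
  move=> Az; apply: contrapT => noT; apply: (Amax (adj A z)).
    split; first exact: sub_adj.
    by move=> /(_ z (adj_self z iA)).
  right; split; first exact: adj_ideal.
    by apply: subset_trans JA _; apply: sub_adj.
  by move=> c Ac Tc; apply: noT; exists c.
apply: contrapT => /not_orP[/big[c Tc [u Au]] /big[d Td [v Av]]].
apply: (AT (c * d)); last exact: TM.
have -> : c * d = (c - u * x) * d + (u * x) * (d - v * y) + u * v * (x * y) by ring.
apply: (idealD iA _ (idealM _ iA Axy)).
exact: (idealD iA (idealMr _ iA Au) (idealM _ iA Av)).
Qed.

Definition chain_snoc (P : nat -> set S) l Q i := if (i <= l)%N then P i else Q.

Lemma prime_chain_snoc (P : nat -> set S) l Q :
  prime_chain l P -> prime_ideal Q -> P l `<` Q ->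
  prime_chain l.+1 (chain_snoc P l Q).
Proof.
move=> [Pp Ps] pQ PQ; rewrite /chain_snoc; split=> i il.
  by case: ifP => // /Pp.
rewrite -ltnS il; case: ltnP => [|li]; first exact: Ps.
by have -> : i = l by lia.
Qed.

(* A nonzerodivisor [a] modulo [K] lies outside some prime between [K] and [Q]:
   [K] misses the multiplicative set of all [u * a ^+ m] with [u] not in [Q]. *)
Lemma wreg_prime_chain J s Q : is_ideal J -> prime_ideal Q ->
  wreg J s -> idl J s `<=` Q ->
  exists P : nat -> set S, [/\ prime_chain (size s) P, P (size s) = Q & J `<=` P 0%N].
Proof.
move=> iJ; elim/last_ind: s Q => [|s a IHs] Q pQ.
  move=> _ JQ; exists (fun=> Q); split=> //; split=> //.
have [iQ Q1 QM] := pQ.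
rewrite wreg_rcons idl_rcons size_rcons => -[rs ra] sQ.
have is_ := idl_ideal s iJ.
pose T := [set x | exists u m, ~ Q u /\ x = u * a ^+ m].
have [||x y|x|P [pP sP PT]] := @prime_avoiding (idl J s) T.
- exact: is_.
- by exists 1, 0%N; rewrite mulr1.
- move=> [u [m [Qu ->]]] [v [m' [Qv ->]]]; exists (u * v), (m + m')%N.
  by rewrite mulrACA exprD; split=> // /QM[].
- move=> sx [u [m [Qu def_x]]]; apply: Qu; apply: sQ.
  apply: sub_adj => //; move: sx; rewrite {x}def_x.
  elim: m => [|m IHm]; rewrite ?mulr1 // exprS mulrCA => /ra.
  exact: IHm.
have PQ : P `<` Q.
  split=> [x Px|].
    by apply: contrapT => Qx; apply: (PT x Px); exists x, 0%N; rewrite mulr1.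
  move=> /(_ a); move=> QP; apply: (PT a).
    by apply: QP; apply: sQ; apply: adj_self.
  by exists 1, 1%N; rewrite mul1r.
have [C [cC Cs JC]] := IHs P pP rs sP.
exists (chain_snoc C (size s) Q); split.
- by apply: prime_chain_snoc => //; rewrite Cs.
- by rewrite /chain_snoc ltnn.
- by [].
Qed.

End Primes.

(** * Ideals and regular sequences in a quotient ring *)

Section Quotient.
Variables (S : comPzRingType) (G : set S).
Local Notation J := (ideal_gen G).
Local Notation A := (qring G).
Implicit Types (x y : S) (s : seq S) (P Q : set A).

Definition qpi (x : S) : A := \pi_(qring G)%qT x.

Lemma qpi_zmod_morphism : zmod_morphism qpi.
Proof. exact: qring_pi_is_zmod_morphism. Qed.

Lemma qpi_monoid_morphism : monoid_morphism qpi.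
Proof. exact: qring_pi_is_monoid_morphism. Qed.

HB.instance Definition _ :=
  GRing.isZmodMorphism.Build S (qring G) qpi qpi_zmod_morphism.
HB.instance Definition _ :=
  GRing.isMonoidMorphism.Build S (qring G) qpi qpi_monoid_morphism.

Lemma qpiD : {morph qpi : x y / x + y}. Proof. exact: raddfD. Qed.
Lemma qpiB : {morph qpi : x y / x - y}. Proof. exact: raddfB. Qed.
Lemma qpiM : {morph qpi : x y / x * y}. Proof. exact: rmorphM. Qed.
Lemma qpi0 : qpi 0 = 0. Proof. exact: rmorph0. Qed.
Lemma qpi1 : qpi 1 = 1. Proof. exact: rmorph1. Qed.

Lemma qpi_repr (z : A) : qpi (repr z) = z. Proof. exact: reprK. Qed.

Lemma qpi_eq x y : qpi x = qpi y <-> J (x - y).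
Proof.
split=> [/eqP xy|Jxy]; first by apply/qring_eqP.
by apply/eqP/qring_eqP.
Qed.

Lemma qpi_eq0 x : qpi x = 0 <-> J x.
Proof. by rewrite -qpi0 qpi_eq subr0. Qed.

Definition pre P : set S := [set x | P (qpi x)].

Lemma pre_ideal P : is_ideal P -> is_ideal (pre P).
Proof.
move=> [P0 PD PM]; split; rewrite /pre /= ?qpi0 // => x y.
  by rewrite qpiD; apply: PD.
by rewrite qpiM; apply: PM.
Qed.

Lemma sub_pre P : is_ideal P -> J `<=` pre P.
Proof. by move=> iP x /qpi_eq0; rewrite /pre /= => ->; apply: ideal0. Qed.

Lemma pre_prime P : prime_ideal P -> prime_ideal (pre P).
Proof.
move=> [iP P1 PM]; split; first exact: pre_ideal.
  by rewrite /pre /= qpi1.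
by move=> x y; rewrite /pre /= qpiM; apply: PM.
Qed.

Lemma pre_maximal P : maximal_ideal P -> maximal_ideal (pre P).
Proof.
move=> mP; have [iP P1 _] := mP; split.
- exact: pre_ideal.
- by rewrite /pre /= qpi1.
- move=> K iK K1 PK; apply/seteqP; split=> // x Kx; apply: contrapT => Px.
  apply: K1; have [c Pc] := maximal_adj mP Px.
  apply: (idealBl iK (y := repr c * x)); last exact: idealM.
  by apply: PK; rewrite /pre /= qpiB qpiM qpi1 qpi_repr.
Qed.

(** Membership is tested on the chosen representative; by [imgE] the choice is immaterial for an
    ideal containing [J]. *)
Definition img (K : set S) : set A := [set z | K (repr z)].

Lemma imgE (K : set S) x : is_ideal K -> J `<=` K -> img K (qpi x) <-> K x.
Proof.
move=> iK JK; have Jx : J (repr (qpi x) - x) by apply/qpi_eq; rewrite qpi_repr.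
by split=> [/(idealBr iK (JK _ Jx))|/(idealBl iK (JK _ Jx))].
Qed.

Lemma img_pre P : img (pre P) = P.
Proof. by apply/seteqP; split=> z; rewrite /img /pre /= qpi_repr. Qed.

Lemma img_ideal (K : set S) : is_ideal K -> J `<=` K -> is_ideal (img K).
Proof.
move=> iK JK; split=> [|x y|x y].
- by rewrite -qpi0; apply/imgE => //; apply: ideal0.
- rewrite -[x]qpi_repr -[y]qpi_repr -qpiD.
  by move=> /(imgE _ iK JK) Kx /(imgE _ iK JK) Ky; apply/imgE => //; apply: idealD.
- rewrite -[x]qpi_repr -[y]qpi_repr -qpiM.
  by move=> /(imgE _ iK JK) Ky; apply/imgE => //; apply: idealM.
Qed.

Lemma img_prime (K : set S) : prime_ideal K -> J `<=` K -> prime_ideal (img K).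
Proof.
move=> [iK K1 KM] JK; split; first exact: img_ideal.
  by rewrite -qpi1 => /(imgE _ iK JK).
move=> x y; rewrite -[x]qpi_repr -[y]qpi_repr -qpiM => /(imgE _ iK JK)/KM.
by case=> Kx; [left | right]; apply/imgE.
Qed.

Lemma pre_chain l (P : nat -> set A) :
  prime_chain l P -> prime_chain l (fun i => pre (P i)).
Proof.
move=> [Pp Ps]; split=> i il; first by apply: pre_prime; apply: Pp.
have [PS nP] := Ps i il; split=> [x|PS']; first exact: PS.
by apply: nP => z Pz; rewrite -[z]qpi_repr; apply: PS'; rewrite /pre /= qpi_repr.
Qed.

Lemma img_chain l (P : nat -> set S) : J `<=` P 0%N ->
  prime_chain l P -> prime_chain l (fun i => img (P i)).
Proof.
move=> JP [Pp Ps].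
have JPi i : (i <= l)%N -> J `<=` P i.
  elim: i => // i IHi il; apply: subset_trans (IHi (ltnW il)) _.
  by have [] := Ps i il.
split=> i il; first by apply: img_prime; [apply: Pp | apply: JPi].
have [PS nP] := Ps i il; split=> [z|PS']; first exact: PS.
have iP j : (j <= l)%N -> is_ideal (P j) by move=> /Pp[].
apply: nP => x Px; apply/(imgE x (iP i (ltnW il)) (JPi i (ltnW il))); apply: PS'.
by apply/imgE => //; [apply: iP | apply: JPi].
Qed.

Lemma ideal_gen_qpi s x :
  ideal_gen [set` [seq qpi a | a <- s]] (qpi x) <-> idl J s x.
Proof.
have iJ := ideal_genP G; have is_ := idl_ideal s iJ.
split=> [sx|sx K iK sK].
  apply/(imgE x is_ (sub_idl s iJ)); apply: sx.
    by apply: img_ideal => //; apply: sub_idl.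
  move=> z /= /mapP[a sa ->]; apply/imgE => //; first exact: sub_idl.
  exact: mem_idl.
have : pre K x by apply: (idl_min (pre_ideal iK)) sx => [|a sa];
  [apply: sub_pre | apply: sK; apply: map_f].
by [].
Qed.

Lemma regular_seq_qpi s :
  regular_seq [seq qpi a | a <- s] <-> wreg J s /\ ~ idl J s 1.
Proof.
rewrite /regular_seq -qpi1 ideal_gen_qpi size_map; split=> [[n1 rs]|[rs n1]].
  split=> //; apply: nth_wreg => i si y.
  have := rs i si (qpi y).
  by rewrite (nth_map 0) // -qpiM -map_take !ideal_gen_qpi.
split=> // i si z; rewrite -[z]qpi_repr (nth_map 0) // -qpiM -map_take.
by rewrite !ideal_gen_qpi; apply: wreg_nth.
Qed.

Lemma seq_qpi (t : seq A) : exists s, t = [seq qpi a | a <- s].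
Proof.
exists [seq repr z | z <- t]; rewrite -map_comp -[LHS]map_id.
by apply: eq_map => z /=; rewrite qpi_repr.
Qed.

End Quotient.

(** * Truncation and leading forms *)

Section MonomialMaps.
Variables (k : fieldType) (n : nat).
Local Notation S := {mpoly k[n]}.
Implicit Types (p q : S) (m : 'X_{1..n}).

(** The [k]-linear extension of [g] from the basis of monomials. *)
Definition mlin (V : lmodType k) (g : 'X_{1..n} -> V) p : V :=
  \sum_(m <- msupp p) p@_m *: g m.

Lemma mlinE (V : lmodType k) (g : 'X_{1..n} -> V) p e : (msize p <= e)%N ->
  mlin g p = \sum_(m : 'X_{1..n < e}) p@_m *: g m.
Proof.
move=> pe; pose I : subFinType _ := 'X_{1..n < e}.
rewrite /mlin (big_mksub I) ?msupp_uniq //=; last first.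
  by move=> x /msize_mdeg_lt /leq_trans; apply.
by rewrite big_rmcond //= => j /memN_msupp_eq0 ->; rewrite scale0r.
Qed.

Lemma mlin_is_linear (V : lmodType k) (g : 'X_{1..n} -> V) : linear (mlin g).
Proof.
move=> c p q; pose e := maxn (msize (c *: p + q)) (maxn (msize p) (msize q)).
rewrite !(mlinE g (e := e)); try by rewrite /e ?leq_max ?leqnn ?orbT.
rewrite scaler_sumr -big_split; apply: eq_bigr => m _ /=.
by rewrite mcoeffD mcoeffZ scalerDl scalerA.
Qed.

HB.instance Definition _ (V : lmodType k) (g : 'X_{1..n} -> V) :=
  GRing.isLinear.Build k S V _ (mlin g) (mlin_is_linear g).

Lemma mlinX (V : lmodType k) (g : 'X_{1..n} -> V) m : mlin g 'X_[m] = g m.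
Proof. by rewrite /mlin msuppX big_seq1 mcoeffX eqxx scale1r. Qed.

Lemma eq_mlinear (V : lmodType k) (f g : {linear S -> V}) :
  (forall m, f 'X_[m] = g 'X_[m]) -> f =1 g.
Proof.
move=> fg p; rewrite (mpolyE p) !linear_sum; apply: eq_bigr => m _.
by rewrite !linearZ /= fg.
Qed.

Lemma mcoeff_mlin_inj (g : 'X_{1..n} -> 'X_{1..n}) (P : pred 'X_{1..n}) p m :
  {in P &, injective g} -> P m ->
  (mlin (fun m => if P m then 'X_[g m] else 0) p)@_(g m) = p@_m.
Proof.
move=> gI Pm; rewrite /mlin raddf_sum /=.
have coefE m' : (p@_m' *: (if P m' then 'X_[g m'] else 0))@_(g m)
    = if m' == m then p@_m else 0.
  rewrite mcoeffZ; case: ifP => Pm'; last first.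
    by case: eqP => [e|]; rewrite ?mcoeff0 ?mulr0 //; rewrite e Pm in Pm'.
  rewrite mcoeffX; case: (m' =P m) => [->|ne]; first by rewrite eqxx mulr1.
  by case: eqP => [/gI|]; rewrite ?mulr0 // => /(_ Pm' Pm).
under eq_bigr do rewrite coefE.
have [mp|mp] := boolP (m \in msupp p).
  rewrite (bigD1_seq m) ?msupp_uniq //= eqxx big1 ?addr0 // => i.
  by move/negbTE ->.
rewrite memN_msupp_eq0 // big1_seq // => i /= _.
by case: ifP.
Qed.

Definition mtrunc E : S -> S :=
  mlin (fun m => if (mdeg m < E)%N then 'X_[m] else 0).

HB.instance Definition _ E := GRing.Linear.on (mtrunc E).

Lemma mtruncX E m : mtrunc E 'X_[m] = if (mdeg m < E)%N then 'X_[m] else 0.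
Proof. exact: mlinX. Qed.

Lemma mcoeff_mtrunc E p m : (mtrunc E p)@_m = if (mdeg m < E)%N then p@_m else 0.
Proof.
case: ifP => Em.
  exact: (mcoeff_mlin_inj (g := id) (P := fun m => (mdeg m < E)%N)).
rewrite /mtrunc /mlin raddf_sum big1 //= => m' _.
rewrite mcoeffZ; case: ifP => Em'; rewrite ?mcoeff0 ?mulr0 // mcoeffX.
by case: eqP => [e|]; rewrite ?mulr0 //; rewrite e Em in Em'.
Qed.

Lemma msupp_mtrunc E p m : m \in msupp (mtrunc E p) -> m \in msupp p.
Proof.
by rewrite !mcoeff_msupp mcoeff_mtrunc; case: ifP => //; rewrite eqxx.
Qed.

Lemma msize_leP p E :
  reflect {in msupp p, forall m, mdeg m < E}%N (msize p <= E)%N.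
Proof.
apply: (iffP idP) => [pE m /msize_mdeg_lt|pE]; first by move/leq_trans; apply.
by rewrite msizeE; apply/bigmax_leqP_seq => m mp _; apply: pE.
Qed.

Lemma mtrunc_id E p : (msize p <= E)%N -> mtrunc E p = p.
Proof.
move=> /msize_leP pE; apply/mpolyP => m; rewrite mcoeff_mtrunc.
by case: ifP => // mE; rewrite memN_msupp_eq0 //; apply: contraFN mE => /pE.
Qed.

Lemma mtrunc0 p : mtrunc 0 p = 0.
Proof. by apply/mpolyP => m; rewrite mcoeff_mtrunc mcoeff0. Qed.

Lemma msize_mtrunc E p : (msize (mtrunc E p) <= E)%N.
Proof.
apply/msize_leP => m; rewrite mcoeff_msupp mcoeff_mtrunc.
by case: ifP => //; rewrite eqxx.
Qed.

Lemma mtrunc_homogM E d p q : p \is d.-homog ->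
  mtrunc E (p * q) = p * mtrunc (E - d) q.
Proof.
move=> /dhomogP hp; rewrite (mpolyE p) !mulr_suml linear_sum.
apply: eq_big_seq => a /hp /= ad; rewrite -!scalerAl linearZ /=; congr (_ *: _).
rewrite (mpolyE q) mulr_sumr !linear_sum mulr_sumr; apply: eq_bigr => b _ /=.
rewrite -scalerAr !linearZ /= -scalerAr; congr (_ *: _).
rewrite -mpolyXD !mtruncX mdegD ad ltn_subRL.
by case: ifP; rewrite ?mulr0 // mpolyXD.
Qed.

Lemma msizeM_ub p q A B :
  (msize p <= A.+1)%N -> (msize q <= B)%N -> (msize (p * q) <= A + B)%N.
Proof.
have [->|p0] := eqVneq p 0; first by rewrite mul0r msize0.
have [->|q0] := eqVneq q 0; first by rewrite mulr0 msize0.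
by rewrite msizeM //; move: (msize p) (msize q) => a b; lia.
Qed.

Lemma msizeD_ub p q E : (msize p <= E)%N -> (msize q <= E)%N ->
  (msize (p + q) <= E)%N.
Proof.
by move=> pE qE; apply: leq_trans (msizeD_le _ _) _; rewrite geq_max pE.
Qed.

Lemma msizeB_ub p q E : (msize p <= E)%N -> (msize q <= E)%N ->
  (msize (p - q) <= E)%N.
Proof. by move=> pE qE; apply: msizeD_ub => //; rewrite msizeN. Qed.

Lemma msize_homog p d : p \is d.-homog -> (msize p <= d.+1)%N.
Proof. by move=> /dhomogP hp; apply/msize_leP => m /hp ->. Qed.

Lemma msize_sub_mtrunc E p : (msize (p - mtrunc E p) <= maxn (msize p) E)%N.
Proof.
apply: msizeB_ub; first exact: leq_maxl.
by apply: leq_trans (msize_mtrunc _ _) _; apply: leq_maxr.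
Qed.

(** For an ideal this says that it is homogeneous. *)
Definition trunc_closed (J : set S) := forall E p, J p -> J (mtrunc E p).

(* [Jh] is the ideal of leading forms of the elements of [Jf]. *)
Definition leading (Jh Jf : set S) :=
  (forall E u, (msize u <= E.+1)%N -> Jf u ->
     exists v, [/\ Jh v, (msize v <= E.+1)%N & (msize (u - v) <= E)%N]) /\
  (forall E v, (msize v <= E.+1)%N -> Jh v ->
     exists u, [/\ Jf u, (msize u <= E.+1)%N & (msize (u - v) <= E)%N]).

Lemma adj_trunc_closed J a d : trunc_closed J -> a \is d.-homog ->
  trunc_closed (adj J a).
Proof.
move=> tJ ha E p [c Jc]; exists (mtrunc (E - d) c).
by rewrite mulrC -(mtrunc_homogM _ _ ha) -raddfB mulrC; apply: tJ.
Qed.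

(** Here [psi] is the form of degree [d] of [phi]; since it is regular modulo [Jh], cancellation
    produces no leading forms outside [Jh + (psi)]. Recall that [msize] exceeds the degree by
    one. *)
Lemma leading_adj Jh Jf psi phi d :
  is_ideal Jh -> is_ideal Jf -> trunc_closed Jh -> psi \is d.-homog ->
  (msize (phi - psi) <= d)%N -> leading Jh Jf ->
  (forall y, Jh (psi * y) -> Jh y) ->
  (forall y, Jf (phi * y) -> Jf y) /\ leading (adj Jh psi) (adj Jf phi).
Proof.
move=> iJh iJf tJh hpsi dpsi [R1 R2] reg.
have psi_le := msize_homog hpsi.
have diff E c : (msize c <= E.+1)%N -> (msize (phi * c - psi * c) <= d + E)%N.
  by move=> cE; rewrite -mulrBl mulrC addnC; apply: msizeM_ub.
have phi_le : (msize phi <= d.+1)%N.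
  by rewrite -(subrK psi phi); apply: msizeD_ub => //; apply: ltnW.
(* If [phi * c] agrees in degree [d + E] with an element of [Jf], regularity of [psi] puts the form
   of degree [E] of [c] in [Jh], so [c] can be lowered modulo [Jf]. *)
have step E c x : (msize c <= E.+1)%N -> Jf x -> (msize x <= (d + E).+1)%N ->
    (msize (x - phi * c) <= d + E)%N ->
    exists w, [/\ Jf w, (msize w <= E.+1)%N & (msize (c - w) <= E)%N].
  move=> cE Jx xE xc.
  have [v [Jv vE xv]] := R1 _ _ xE Jx.
  have pcv : (msize (psi * c - v) <= d + E)%N.
    have -> : psi * c - v = (x - v) - ((x - phi * c) + (phi * c - psi * c)) by ring.
    by apply: msizeB_ub => //; apply: msizeD_ub => //; apply: diff.
  have := mtrunc_id pcv; rewrite raddfB /= (mtrunc_homogM _ _ hpsi) addKn => /eqP.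
  rewrite subr_eq => /eqP e.
  have : Jh (psi * (c - mtrunc E c)).
    rewrite mulrBr e.
    have -> : psi * c - (psi * c - v + mtrunc (d + E) v) = v - mtrunc (d + E) v by ring.
    by apply: idealB => //; apply: tJh.
  move/reg => Jc; have cE' : (msize (c - mtrunc E c) <= E.+1)%N.
    by apply: leq_trans (msize_sub_mtrunc _ _) _; rewrite geq_max cE /=.
  have [w [Jw wE wc]] := R2 _ _ cE' Jc.
  exists w; split=> //.
  have -> : c - w = mtrunc E c - (w - (c - mtrunc E c)) by ring.
  by apply: msizeB_ub => //; apply: msize_mtrunc.
split=> [y|].
  have [E yE] : exists E, (msize y <= E)%N by exists (msize y).
  elim: E y yE => [|E IHE] y yE Jy.
    move: yE; rewrite leqn0 msize_poly_eq0 => /eqP ->.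
    exact: ideal0.
  have [||w [Jw _ yw]] := step E y _ yE Jy.
  - by rewrite -addnS; apply: msizeM_ub.
  - by rewrite subrr msize0.
  apply: (idealBl iJf (y := w)) => //; apply: IHE => //.
  by rewrite mulrBr; apply: idealB => //; apply: idealM.
(* For [u] in [Jf + (phi)] the multiplier [c] is lowered until [c * phi] has degree at most [E];
   beyond that degree it cancels against an element of [Jf]. *)
split=> E u uE.
  case=> c; have [C] := ubnPleq (msize c).
  elim: C c => [|C IHC] c cC Jc.
    move: cC; rewrite leqn0 msize_poly_eq0 => /eqP c0.
    rewrite c0 mul0r subr0 in Jc.
    have [v [Jv vE uv]] := R1 _ _ uE Jc.
    by exists v; split=> //; apply: sub_adj.
  have [dCE|dCE] := leqP (d + C) E.
    have cphi : (msize (c * phi) <= E.+1)%N.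
      by rewrite mulrC; apply: leq_trans (msizeM_ub phi_le cC) _; lia.
    have [|v [Jv vE uv]] := R1 E (u - c * phi) _ Jc; first exact: msizeB_ub.
    exists (v + c * psi); split.
    - by exists c; rewrite addrK.
    - apply: msizeD_ub => //; rewrite mulrC.
      by apply: leq_trans (msizeM_ub psi_le cC) _; lia.
    - have -> : u - (v + c * psi) = (u - c * phi - v) + (phi * c - psi * c) by ring.
      by apply: msizeD_ub => //; apply: leq_trans (diff _ _ cC) _.
  have cphi : (msize (c * phi) <= (d + C).+1)%N.
    by rewrite mulrC; apply: leq_trans (msizeM_ub phi_le cC) _; lia.
  have [||||w [Jw wC cw]] := step C (- c) (u - c * phi) => //.
  - by rewrite msizeN.
  - by apply: msizeB_ub => //; lia.
  - have -> : u - c * phi - phi * - c = u by ring.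
    by apply: leq_trans uE _.
  apply: (IHC (c + w)).
    by rewrite -msizeN opprD.
  have -> : u - (c + w) * phi = (u - c * phi) - phi * w by ring.
  by apply: idealB => //; apply: idealM.
(* Conversely, truncation makes both parts of an element of [Jh + (psi)] of degree at most [E]; the
   first is lifted to [Jf], and in the second [psi] is replaced by [phi]. *)
case=> c Jc.
have [u' [Ju' u'E u'v]] : exists u', [/\ Jf u', (msize u' <= E.+1)%N &
    (msize (u' - mtrunc E.+1 (u - c * psi)) <= E)%N].
  by apply: R2; [apply: msize_mtrunc | apply: tJh].
have def_u : u = mtrunc E.+1 (u - c * psi) + mtrunc (E.+1 - d) c * psi.
  by rewrite raddfB /= mulrC (mtrunc_homogM _ _ hpsi) mtrunc_id // mulrC subrK.
set c' := mtrunc _ c in def_u; set v' := mtrunc _ _ in u'v def_u.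
have c'E : (msize c' <= E.+1 - d)%N by apply: msize_mtrunc.
have c'phi (f : S) : (msize f <= d.+1)%N -> (msize (c' * f) <= E.+1)%N.
  move=> fd; have [Ed|dE] := leqP d E.+1.
    rewrite mulrC; apply: leq_trans (msizeM_ub fd c'E) _.
    by lia.
  have : (msize c' <= 0)%N by apply: leq_trans c'E _; lia.
  by rewrite leqn0 msize_poly_eq0 => /eqP ->; rewrite mul0r msize0.
exists (u' + c' * phi); split.
- by exists c'; rewrite addrK.
- by apply: msizeD_ub => //; apply: c'phi.
rewrite {}def_u.
have -> : u' + c' * phi - (v' + c' * psi) = (u' - v') + (phi * c' - psi * c') by ring.
apply: msizeD_ub => //.
have [dE|Ed] := leqP d E.
  apply: leq_trans (diff (E - d)%N _ _) _; first by rewrite -subSn.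
  by lia.
have [e0|] := eqVneq d E.+1.
  have : (msize c' <= 0)%N by apply: leq_trans c'E _; lia.
  by rewrite leqn0 msize_poly_eq0 => /eqP ->; rewrite !mulr0 subrr msize0.
have : (msize c' <= 0)%N by apply: leq_trans c'E _; lia.
by rewrite leqn0 msize_poly_eq0 => /eqP ->; rewrite !mulr0 subrr msize0.
Qed.

Lemma wreg_leading Jh Jf (psis phis : seq S) :
  is_ideal Jh -> is_ideal Jf -> trunc_closed Jh -> leading Jh Jf ->
  size psis = size phis ->
  (forall i, (i < size psis)%N -> exists d, psis`_i \is d.-homog /\
     (msize (phis`_i - psis`_i) <= d)%N) ->
  wreg Jh psis -> wreg Jf phis.
Proof.
elim: psis phis Jh Jf => [|psi psis IH] [|phi phis] //= Jh Jf iJh iJf tJh lJ.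
move=> [sz] hs [reg regs].
have [d [hpsi dpsi]] := hs 0%N isT.
have [rphi lJ'] := leading_adj iJh iJf tJh hpsi dpsi lJ reg.
split=> //; apply: (IH phis (adj Jh psi)) => //; try exact: adj_ideal.
- exact: adj_trunc_closed hpsi.
- by move=> i ip; apply: (hs i.+1).
Qed.

Lemma leading_refl J : leading J J.
Proof.
by split=> E u uE Ju; exists u; rewrite subrr msize0.
Qed.

End MonomialMaps.

(** * Dimension *)

Lemma linear_dependence (k : fieldType) (T1 T2 : finType) (A : T1 -> T2 -> k) :
  (#|T2| < #|T1|)%N ->
  exists c : T1 -> k, (exists x, c x != 0) /\ forall y, \sum_x c x * A x y = 0.
Proof.
move=> T21; pose M := \matrix_(i < #|T1|, j < #|T2|) A (enum_val i) (enum_val j).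
have : kermx M != 0.
  rewrite kermx_eq0 /row_free neq_ltn.
  by rewrite (leq_ltn_trans (rank_leq_col M) T21).
case/rowV0Pn => v /sub_kermxP vM v0.
exists (fun x => v 0 (enum_rank x)); split.
  by have /rV0Pn[i vi] := v0; exists (enum_val i); rewrite enum_valK.
move=> y; have /rowP/(_ (enum_rank y)) := vM; rewrite !mxE => {2}<-.
rewrite (reindex (@enum_val T1 predT)) /=.
  by apply: eq_bigr => i _; rewrite !mxE enum_valK enum_rankK.
by apply: onW_bij; exists (@enum_rank T1); [apply: enum_valK | apply: enum_rankK].
Qed.

Section Dimension.
Variables (k : fieldType) (n : nat).
Local Notation S := {mpoly k[n]}.

(* The lexicographically lowest term of a polynomial relation cannot cancel. *)
Lemma prime_chain_independent l t (P : nat -> set S) (f : 'I_l -> S)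
    (c : {ffun 'I_l -> 'I_t} -> k) :
  prime_chain l P -> (forall i : 'I_l, P i.+1 (f i) /\ ~ P i (f i)) ->
  P 0%N (\sum_m c m *: \prod_i f i ^+ m i) -> forall m, c m = 0.
Proof.
move=> [Pp Ps] fP P0 m0; apply/eqP; apply: contrapT => /negP cm0.
have idP i : (i <= l)%N -> is_ideal (P i) by move=> /Pp[].
(* At stage [j] the exponents in [X] agree in the coordinates below [j], whose factors have been
   divided out. *)
pose lowest j (X : {set {ffun 'I_l -> 'I_t}}) := [/\ exists m, m \in X,
  forall m, m \in X -> c m != 0,
  forall m m' (i : 'I_l), m \in X -> m' \in X -> (i < j)%N -> m i = m' i &
  P j (\sum_(m in X) c m *: \prod_(i : 'I_l | (j <= i)%N) f i ^+ m i)].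
have [X [mX cX agX]] : exists X, lowest l X.
  suff: forall j, (j <= l)%N -> exists X, lowest j X by move/(_ l (leqnn l)).
  elim=> [_|j IHj jl].
    exists [set m | c m != 0]%SET; split=> [|m|m m' i _ _ //|].
    - by exists m0; rewrite inE.
    - by rewrite inE.
    - rewrite (bigID (fun m => c m != 0)) /= [X in _ + X]big1 in P0; last first.
        by move=> m; rewrite negbK => /eqP ->; rewrite scale0r.
      by rewrite addr0 in P0; under eq_bigl do rewrite inE.
  have [X [[mX Xm] cX agX PX]] := IHj (ltnW jl).
  pose oj := Ordinal jl.
  (* The least power of [f oj] can be cancelled because [f oj] is not in the prime [P j]; modulo
     [P j.+1], which contains [f oj], only the terms with that exponent remain. *)
  have [mu Xmu mu_min] := @arg_minnP _ mX (fun m => m \in X)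
    (fun m => m oj : nat) Xm.
  have PX' : P j (\sum_(m in X) c m *: (f oj ^+ (m oj - mu oj) *
                \prod_(i : 'I_l | (j < i)%N) f i ^+ m i)).
    have [_ _ PM] := Pp j (ltnW jl).
    have [//||//] := PM (f oj ^+ mu oj) (\sum_(m in X) c m *:
      (f oj ^+ (m oj - mu oj) * \prod_(i : 'I_l | (j < i)%N) f i ^+ m i)).
      move: PX; congr (P j _); rewrite mulr_sumr; apply: eq_bigr => m mX'.
      rewrite (bigD1 oj) //= -scalerAr mulrA -exprD subnKC; last exact: mu_min.
      congr (_ *: (_ * _)); apply: eq_bigl => i.
      by rewrite andbC -val_eqE /= [RHS]ltn_neqAle eq_sym.
    by move/(prime_ideal_expr (Pp j (ltnW jl))) => /(proj2 (fP oj)).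
  exists [set m in X | m oj == mu oj]%SET; split.
  - by exists mu; rewrite inE Xmu eqxx.
  - by move=> m; rewrite inE => /andP[/cX].
  - move=> m m' i; rewrite !inE => /andP[Xm1 /eqP m1] /andP[Xm2 /eqP m2].
    rewrite ltnS leq_eqVlt => /predU1P[ij|]; last exact: agX.
    by have -> : i = oj; [apply: val_inj | rewrite m1].
  - have {}PX' : P j.+1 (\sum_(m in X) c m *: (f oj ^+ (m oj - mu oj) *
                \prod_(i : 'I_l | (j < i)%N) f i ^+ m i)).
      by have [PS _] := Ps j jl; apply: PS.
    rewrite (bigID (fun m : {ffun 'I_l -> 'I_t} => m oj == mu oj)) /= in PX'.
    set B := (X in _ + X) in PX'.
    have PB : P j.+1 B.
      apply: ideal_sum => [|m /andP[Xm' mj]]; first exact: idP.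
      have : (0 < m oj - mu oj)%N.
        by rewrite subn_gt0 ltn_neqAle mu_min // andbT eq_sym.
      case: (_ - _)%N => // d _; rewrite exprS -mul_mpolyC -mulrA.
      apply: idealM; first exact: idP.
      by apply: idealMr; [apply: idP | case: (fP oj)].
    have := idealB (idP _ jl) PX' PB; rewrite addrK; congr (P j.+1 _).
    apply: eq_big => m; first by rewrite !inE.
    by move=> /andP[_ /eqP ->]; rewrite subnn mul1r.
move=> PX; case: mX => m Xm.
have {}PX : P l (c m)%:MP.
  move: PX; congr (P l _); rewrite (bigD1 m) //= [X in _ + X]big1 => [|m' /andP[Xm' /eqP mm']].
    rewrite addr0 big_pred0 => [|i]; first by rewrite -mul_mpolyC mulr1.
    by rewrite leqNgt ltn_ord.
  by case: mm'; apply/ffunP => i; apply: agX.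
have [_ P1 _] := Pp l (leqnn l); apply: P1.
have -> : 1 = (c m)^-1%:MP * (c m)%:MP :> S.
  by rewrite -mpolyCM mulVf ?mpolyC1 // cX.
exact: idealM (idP _ (leqnn l)) PX.
Qed.

Lemma msize_expr_le (p : S) A e : (msize p <= A.+1)%N -> (msize (p ^+ e) <= (e * A).+1)%N.
Proof.
move=> pA; elim: e => [|e IHe]; first by rewrite expr0 msize1.
by rewrite exprS mulSn -addnS; apply: msizeM_ub.
Qed.

Lemma msize_prod_le l (F : 'I_l -> S) A :
  (forall i, (msize (F i) <= A.+1)%N) ->
  (msize (\prod_i F i) <= (l * A).+1)%N.
Proof.
elim: l F => [|l IHl] F FA; first by rewrite big_ord0 msize1.
by rewrite big_ord_recl mulSn -addnS; apply: msizeM_ub => //; apply: IHl.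
Qed.

Lemma monomial_sum_in (P : set S) (p : S) : is_ideal P ->
  {in msupp p, forall m, P 'X_[m]} -> P p.
Proof.
move=> iP pP; rewrite [p]mpolyE big_seq; apply: ideal_sum => // m /pP.
by rewrite -mul_mpolyC; apply: idealM.
Qed.

Lemma prime_monomial (P : set S) (m : 'X_{1..n}) : prime_ideal P ->
  P 'X_[m] <-> exists2 i, m i != 0%N & P 'X_i.
Proof.
move=> pP; have [iP P1 PM] := pP; split=> [|[i mi Pi]]; last first.
  have -> : m = (U_(i) + (m - U_(i)))%MM.
    by rewrite addmC submK // lep1mP.
  by rewrite mpolyXD; apply: idealMr.
rewrite mpolyXE_id => Pm; apply: contrapT => noi; move: Pm.
apply: (big_ind (fun x => ~ P x)) => // [x y Px Py /PM[]//|i _].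
have [->|mi] := eqVneq (m i) 0%N; first by rewrite expr0.
by move/(prime_ideal_expr pP) => Pi; apply: noi; exists i.
Qed.

(** Modulo [P 0%N] only monomials in the variables of [F] survive. Were [l > #|F|], the products of
    powers of the [f i] would outnumber these monomials in the relevant degrees and satisfy a linear
    relation, against their independence. *)
Lemma prime_chain_le l (P : nat -> set S) :
  prime_chain l P -> (l <= #|[set i | `[< ~ P 0%N 'X_i >]]%SET|)%N.
Proof.
set F := [set i | _]%SET => cP; rewrite leqNgt; apply/negP => Fl.
have [Pp Ps] := cP; have p0 := Pp 0%N (leq0n l).
have [f fP] : exists f : 'I_l -> S, forall i : 'I_l, P i.+1 (f i) /\ ~ P i (f i).
  suff /choice[f fP] : forall i : 'I_l, exists x, P i.+1 x /\ ~ P i x by exists f.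
  move=> i; have [_ nP] := Ps i (ltn_ord i).
  apply: contrapT => nof; apply: nP => x Px; apply: contrapT => nPx.
  by apply: nof; exists x.
have [A fA] : exists A, forall i, (msize (f i) <= A.+1)%N.
  exists (\max_i msize (f i))%N => i; apply: leqW.
  exact: (leq_bigmax_cond (F := fun i => msize (f i))).
(* Products with exponents below [t] have degree below [B], and [B <= (l * A).+1 * t]; so the
   monomials number at most [(l * A).+1 ^ #|F| * t ^ #|F| < t ^ #|F|.+1 <= t ^ l]. *)
pose t := ((l * A).+1 ^ #|F|).+1; pose B := (l * (t * A)).+1.
pose T2 := {ffun {i | i \in F} -> 'I_B}.
pose T1 := {ffun 'I_l -> 'I_t}.
have card : (#|T2| < #|T1|)%N.
  rewrite !card_ffun !card_ord card_sig.
  rewrite (leq_trans (n := (((l * A).+1 * t) ^ #|F|).+1)) //.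
    by rewrite ltnS; case: #|F| => // r; rewrite leq_exp2r //; nia.
  have -> : (t ^ l = t * t ^ #|F| * t ^ (l - #|F|.+1))%N.
    by rewrite -expnS -expnD subnKC.
  rewrite expnMn.
  have t0 : (0 < t ^ (l - #|F|.+1))%N by rewrite expn_gt0.
  apply: leq_trans (leq_pmulr _ t0).
  rewrite ltn_pmul2r; last by rewrite expn_gt0.
  exact: ltnSn.
pose mon (y : T2) : 'X_{1..n} :=
  [multinom (if insub i is Some z then y z : nat else 0%N) | i < n].
have [c [[m0 cm0] crel]] := linear_dependence
  (fun (m : T1) (y : T2) => (\prod_i f i ^+ m i)@_(mon y)) card.
move/eqP: cm0; apply; apply: (prime_chain_independent cP fP).
apply: monomial_sum_in; first by case: p0.
move=> m msum; apply/prime_monomial => //; apply: contrapT => noi.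
move: msum; rewrite mcoeff_msupp => /eqP; apply.
have mF i : m i != 0%N -> i \in F.
  by move=> mi; rewrite inE; apply/asboolP => Pi; apply: noi; exists i.
rewrite raddf_sum /=; under eq_bigr do rewrite mcoeffZ.
have [mB|Bm] := ltnP (mdeg m) B; last first.
  apply: big1 => m' _; rewrite memN_msupp_eq0 ?mulr0 //.
  apply: contraTN Bm => /msize_mdeg_lt h; rewrite -ltnNge.
  apply: leq_trans h _; apply: msize_prod_le => i.
  apply: leq_trans (msize_expr_le _ (fA i)) _.
  by rewrite ltnS leq_mul2r (ltnW (ltn_ord _)) orbT.
pose y : T2 := [ffun z => inord (m (val z))].
have def_m : m = mon y.
  apply/mnmP => i; rewrite mnmE; case: insubP => [z Fi zi|Fi].
    rewrite ffunE zi inordK // (leq_trans _ mB) // ltnS mdegE.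
    by rewrite (bigD1 i) //= leq_addr.
  by apply/eqP; apply: contraNT Fi; apply: mF.
by rewrite def_m; apply: crel.
Qed.

End Dimension.

(** * Zariski's lemma *)

Lemma digits_inj B m (a b : 'I_m -> nat) :
  (forall i, a i < B)%N -> (forall i, b i < B)%N ->
  (\sum_i a i * B ^ i)%N = (\sum_i b i * B ^ i)%N -> a =1 b.
Proof.
elim: m a b => [|m IHm] a b aB bB; first by move=> _ [].
rewrite !big_ord_recl /= !expn0 !muln1.
have shift (c : 'I_m.+1 -> nat) :
  (\sum_(i < m) c (lift ord0 i) * B ^ (bump 0 i) =
   (\sum_(i < m) c (lift ord0 i) * B ^ i) * B)%N.
  rewrite big_distrl /=; apply: eq_bigr => i _.
  by rewrite /bump /= add1n expnSr mulnA.
rewrite !shift => e.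
have B0 : (0 < B)%N by apply: leq_ltn_trans (aB ord0).
have e0 : a ord0 = b ord0.
  have := congr1 (modn^~ B) e.
  by rewrite /= ![(a ord0 + _)%N]addnC ![(b ord0 + _)%N]addnC !modnMDl !modn_small.
move: e; rewrite e0 => /addnI/eqP; rewrite eqn_pmul2r // => /eqP e.
have es := IHm _ _ (fun i => aB _) (fun i => bB _) e.
by move=> i; case: (unliftP ord0 i) => [j|] -> //; apply: es.
Qed.

Section Zariski.
Variable k : fieldType.

Lemma rmorph_mmap m (R' S' : comNzRingType) (f : {rmorphism k -> R'})
    (h : 'I_m -> R') (psi : {rmorphism R' -> S'}) g :
  psi (mmap f h g) = mmap (psi \o f) (psi \o h) g.
Proof.
rewrite /mmap rmorph_sum; apply: eq_bigr => mu _.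
rewrite rmorphM; congr (_ * _); rewrite /mmap1 rmorph_prod.
by apply: eq_bigr => i _; rewrite rmorphXn.
Qed.

Lemma eq_mmap m (K : comNzRingType) (f g : k -> K) (x y : 'I_m -> K) p :
  f =1 g -> x =1 y -> mmap f x p = mmap g y p.
Proof.
move=> fg xy; apply: eq_bigr => mu _; rewrite fg; congr (_ * _).
by apply: eq_bigr => i _; rewrite xy.
Qed.

Variables (K : comNzRingType) (iota : {rmorphism k -> K}).

Lemma integral_exp (y : K) e : integralOver iota y -> integralOver iota (y ^+ e).
Proof.
move=> iy; elim: e => [|e IHe]; first exact: integral1.
by rewrite exprS; apply: integral_mul.
Qed.

Lemma integral_mmap m (x : 'I_m -> K) g :
  (forall i, integralOver iota (x i)) -> integralOver iota (mmap iota x g).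
Proof.
move=> ix; apply: (big_ind (integralOver iota)) => [||mu _].
- exact: integral0.
- exact: integral_add.
- apply: integral_mul; first exact: integral_id.
  apply: (big_ind (integralOver iota)); [exact: integral1|exact: integral_mul|].
  by move=> i _; apply: integral_exp.
Qed.

Section Noether.
Variables (m : nat) (B : nat).
Local Notation A := {mpoly k[m]}.

(* The change of variables x_i -> x_i + x_0 ^ (B ^ i), i > 0, makes every
   polynomial with exponents less than B monic in x_0 up to a constant. *)
Definition noether_var (i : 'I_m.+1) : {poly A} :=
  if unlift ord0 i is Some j then 'X^(B ^ i) + ('X_j)%:P else 'X.

Definition noether_poly (g : {mpoly k[m.+1]}) : {poly A} :=
  mmap (polyC \o @mpolyC m k) noether_var g.

Hypothesis B0 : (0 < B)%N.

Lemma noether_var_monic i : noether_var i \is monic /\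
  size (noether_var i) = (B ^ i).+1.
Proof.
rewrite /noether_var; case: unliftP => [j|] ->.
  by rewrite monicXnaddC ?size_XnaddC ?expn_gt0 ?B0.
by rewrite monicX size_polyX.
Qed.

Lemma noether_mmap1 mu : mmap1 noether_var mu \is monic /\
  size (mmap1 noether_var mu) = (\sum_i mu i * B ^ i).+1.
Proof.
rewrite /mmap1; apply: (big_rec2 (fun (p : {poly A}) s => p \is monic /\ size p = s.+1)).
  by rewrite monic1 size_poly1.
move=> i s p _ [mp sp]; have [mv sv] := noether_var_monic i.
split; first by rewrite monicMl // monic_exp.
rewrite size_mul ?monic_neq0 ?monic_exp // sp addnS /=.
have -> : size (noether_var i ^+ mu i) = (mu i * B ^ i).+1.
  have := size_exp (noether_var i) (mu i); rewrite sv /= mulnC => <-.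
  by rewrite prednK // size_poly_gt0 monic_neq0 // monic_exp.
by rewrite addSn.
Qed.

Variable x : 'I_m.+1 -> K.
(** The point [x] in the new coordinates. *)
Definition noether_pt (j : 'I_m) : K :=
  x (lift ord0 j) - x ord0 ^+ (B ^ lift ord0 j).

Let psi : A -> K := mmap iota noether_pt.

Lemma noether_eval g : (map_poly (mmap iota noether_pt) (noether_poly g)).[x ord0]
  = mmap iota x g.
Proof.
rewrite -[LHS]/((horner_eval (x ord0) \o map_poly (mmap iota noether_pt))
  (noether_poly g)) /noether_poly rmorph_mmap; apply: eq_mmap => [c|i] /=.
  by rewrite map_polyC /horner_eval hornerC /psi /= mmapC.
rewrite /horner_eval /= /noether_var; case: unliftP => [j|] -> /=.
  rewrite rmorphD /= map_polyXn map_polyC hornerD hornerXn hornerC /psi /=.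
  by rewrite mmapX mmap1U /noether_pt addrC subrK.
by rewrite map_polyX hornerX.
Qed.

(** The monomial [mu] becomes monic of degree [\sum_i mu i * B ^ i]. The exponents are the base-[B]
    digits of this number, so a single monomial of [g] attains the largest degree. *)
Lemma noether_poly_monic g : g != 0 -> (msize g <= B)%N ->
  exists2 c : k, c != 0 & c%:MP%:P * noether_poly g \is monic.
Proof.
move=> g0 gB; pose w (mu : 'X_{1..m.+1}) := (\sum_i mu i * B ^ i)%N.
have wI : {in msupp g &, injective w}.
  have digit mu i : mu \in msupp g -> (mu i < B)%N.
    move=> /msize_mdeg_lt /leq_trans /(_ gB); apply: leq_ltn_trans.
    by rewrite mdegE (bigD1 i) //= leq_addr.
  move=> mu nu gmu gnu /digits_inj e; apply/mnmP; apply: e => i; exact: digit.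
have [mu gmu mu_max] : exists2 mu, mu \in msupp g &
    {in msupp g, forall nu, nu != mu -> (w nu < w mu)%N}.
  have [s0|s0] := boolP (msupp g == [::]); first by rewrite msupp_eq0 (negbTE g0) in s0.
  have [mu gmu mumax] : exists2 mu, mu \in msupp g &
      {in msupp g, forall nu, (w nu <= w mu)%N}.
    elim: (msupp g) s0 => // a [|b s] IHs _.
      by exists a; rewrite ?mem_head // => nu; rewrite inE => /eqP ->.
    have [mu smu mumax] := IHs isT.
    have [wa|wa] := leqP (w a) (w mu).
      exists mu; first by rewrite inE smu orbT.
      by move=> nu; rewrite inE => /predU1P[->|/mumax].
    exists a; first exact: mem_head.
    move=> nu; rewrite inE => /predU1P[->|/mumax] // h.
    exact: leq_trans h (ltnW wa).
  exists mu => // nu gnu ne; rewrite ltn_neqAle mumax // andbT.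
  by apply: contra ne => /eqP /wI -> //.
exists (g@_mu)^-1; first by rewrite invr_eq0 -mcoeff_msupp.
have cg : g@_mu != 0 by rewrite -mcoeff_msupp.
have [mT sT] := noether_mmap1 mu.
rewrite /noether_poly /mmap (bigD1_seq mu) ?msupp_uniq //= mulrDr mulrA.
rewrite -!polyCM -mpolyCM mulVf // mpolyC1 mul1r.
rewrite monicE lead_coefDl ?(monicP mT) // sT ltnS.
rewrite mulr_sumr; apply: leq_trans (size_sum _ _ _) _.
rewrite big_seq_cond; apply/bigmax_leqP_seq => nu gnu /andP[_ ne].
rewrite mulrA -polyCM mul_polyC.
apply: leq_trans (size_scale_leq _ _) _.
by have [_ ->] := noether_mmap1 nu; apply: mu_max.
Qed.

End Noether.

(** The hypothesis says that [k[x]] is a field. The induction removes one generator by the change of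
    variables. *)
Lemma zariski m (x : 'I_m -> K) :
  (forall g, mmap iota x g != 0 -> exists h, mmap iota x g * mmap iota x h = 1) ->
  forall i, integralOver iota (x i).
Proof.
elim: m x => [|m IHm] x fieldx; first by case.
have [[g g0 gx]|nog] := pselect (exists2 g, g != 0 & mmap iota x g = 0); last first.
  (* Without a relation [k[x]] would be a polynomial ring, where ['X_ord0] has no inverse. *)
  have X0 : mmap iota x 'X_ord0 != 0.
    apply/eqP => Xx; apply: nog; exists 'X_ord0 => //.
    by rewrite -msize_poly_eq0 msizeX.
  have [h] := fieldx _ X0; rewrite -rmorphM => /eqP; rewrite -subr_eq0.
  rewrite -(rmorph1 (mmap iota x)) -rmorphB => /eqP h0.
  have /eqP : 'X_ord0 * h - 1 = 0 :> {mpoly k[m.+1]}.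
    by apply: contrapT => /eqP ne; apply: nog; exists ('X_ord0 * h - 1).
  rewrite subr_eq0 => /eqP /(congr1 (meval (fun=> 0))).
  by rewrite mevalM mevalXU mul0r meval1 => /esym/eqP; rewrite oner_eq0.
pose B := msize g.
have B0 : (0 < B)%N by rewrite lt0n msize_poly_eq0.
pose y := noether_pt B x; pose psi := mmap iota y.
have [c c0 mon] := noether_poly_monic B0 g0 (leqnn B).
set P := _ * _ in mon.
have rootP : root (map_poly psi P) (x ord0).
  rewrite /root /P rmorphM /= hornerM noether_eval gx mulr0.
  by [].
have int_psi z : {in map_poly psi z : seq K, integralRange psi}.
  by apply/integral_poly => i; rewrite coef_map; apply: integral_id.
(* The subring [k[y]] is again a field: the inverse [z] of [psi g'] is integral over it, and
   multiplying an equation of degree [e.+1] by [psi g' ^+ e] expresses [z] in [k[y]]. *)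
have inty : forall i, integralOver iota (y i).
  apply: IHm => g' g'0.
  pose sub : {mpoly k[m.+1]} := g' \mPo [tuple 'X_(lift ord0 i)
     - 'X_ord0 ^+ (B ^ lift ord0 i) | i < m].
  have subE : mmap iota x sub = psi g'.
    rewrite /sub /comp_mpoly rmorph_mmap; apply: eq_mmap => [a|i] /=.
      by rewrite mmapC.
    by rewrite tnth_mktuple rmorphB rmorphXn /= !mmapX !mmap1U.
  have [h] : exists h, psi g' * mmap iota x h = 1.
    by have := fieldx sub; rewrite subE; apply.
  set z := mmap iota x h => az.
  have [p mp] : integralOver psi z.
    rewrite /z -(noether_eval B); apply: integral_horner_root rootP _ _ => //.
    exact: monic_map.
  rewrite /root => /eqP pz.
  have sp0 : (0 < size p)%N by rewrite size_poly_gt0 monic_neq0.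
  case def_e : (size p) sp0 => [//|e] _.
  have zE : z ^+ e = - \sum_(i < e) psi p`_i * z ^+ i.
    apply/eqP; rewrite -addr_eq0 addrC; apply/eqP; rewrite -[RHS]pz.
    rewrite (@horner_coef_wide _ e.+1); last by rewrite -def_e; apply: size_poly.
    rewrite big_ord_recr /= !coef_map /=; congr (_ + _).
      by apply: eq_bigr => i _; rewrite coef_map.
    by have := monicP mp; rewrite /lead_coef def_e /= => ->; rewrite rmorph1 mul1r.
  case: e zE def_e => [|e] zE _.
    move: zE; rewrite expr0 big_ord0 oppr0 => /eqP.
    by rewrite oner_eq0.
  exists (- \sum_(i < e.+1) p`_i * g' ^+ (e - i)).
  rewrite -/psi -az; congr (_ * _).
  have -> : z = psi g' ^+ e * z ^+ e.+1 by rewrite exprS mulrCA -exprMn az expr1n mulr1.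
  rewrite zE -[LHS]/(mmap iota y _) rmorphN mulrN; congr (- _).
  rewrite rmorph_sum mulr_sumr; apply: eq_bigr => i _.
  rewrite rmorphM rmorphXn mulrCA; congr (_ * _).
  have ie : (i <= e)%N by rewrite -ltnS.
  have -> : psi g' ^+ e = psi g' ^+ (e - i) * psi g' ^+ i by rewrite -exprD subnK.
  by rewrite -mulrA -exprMn az expr1n mulr1.
have int0 : integralOver iota (x ord0).
  apply: integral_root_monic rootP _; first exact: monic_map.
  by apply/integral_poly => i; rewrite coef_map; apply: integral_mmap.
move=> i; case: (unliftP ord0 i) => [j|] -> //.
rewrite -[x _](subrK (x ord0 ^+ (B ^ lift ord0 j))).
by apply: integral_add; [apply: inty | apply: integral_exp].
Qed.

End Zariski.

Lemma ideal_gen_id (R : comPzRingType) (J : set R) : is_ideal J -> ideal_gen J = J.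
Proof.
by move=> iJ; apply/seteqP; split=> x; [apply | move=> Jx K _; apply].
Qed.

(** The quotient by [Q] is a field generated over [k] by the classes of the variables, so Zariski's
    lemma applies. *)
Lemma maximal_ideal_algebraic (k : fieldType) n (Q : set {mpoly k[n]}) f :
  maximal_ideal Q -> exists2 p : {poly k}, p \is monic &
    Q (map_poly (@mpolyC n k) p).[f].
Proof.
move=> mQ; have [iQ Q1 _] := mQ.
have QE g : qpi Q g = 0 <-> Q g by rewrite qpi_eq0 ideal_gen_id.
have n10 : (1 : qring Q) != 0 by rewrite -(qpi1 Q); apply/eqP => /QE.
pose K : comNzRingType := HB.pack (qring Q)
  (GRing.PzSemiRing_isNonZero.Build (qring Q) n10).
pose F : {rmorphism {mpoly k[n]} -> K} := qpi Q.
pose iota : {rmorphism k -> K} := F \o @mpolyC n k.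
have FE g : mmap iota (F \o fun i => 'X_i) g = F g.
  rewrite -rmorph_mmap; congr (F _); rewrite -[RHS]comp_mpoly_id /comp_mpoly.
  by apply: eq_mmap => // i; rewrite tnth_mktuple.
have [p mp pf] : integralOver iota (F f).
  rewrite -FE; apply: integral_mmap; apply: zariski => g; rewrite FE => /eqP Fg.
  have [|c Qc] := maximal_adj (x := g) mQ; first by move/QE.
  exists c; rewrite FE -rmorphM -(rmorph1 F); apply/eqP.
  rewrite -subr_eq0 -rmorphB -oppr_eq0 -rmorphN opprB mulrC; apply/eqP.
  exact/QE.
exists p => //; apply/QE; move: pf; rewrite /root map_poly_comp.
by rewrite (horner_map F) => /eqP.
Qed.

(** * Monomial ideals *)

Section MonomialIdeals.
Variables (k : fieldType) (n : nat).
Local Notation S := {mpoly k[n]}.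
Implicit Types (U : 'X_{1..n} -> Prop) (F G : {set 'I_n}) (p : S).

(** The span of the monomials with exponents in [U]; for upsets [U] these are the monomial
    ideals. *)
Definition monid U : set S := [set p | forall m, m \in msupp p -> U m].

Definition upset U := forall m m', (m <= m')%MM -> U m -> U m'.

Lemma monid_ideal U : upset U -> is_ideal (monid U).
Proof.
move=> upU; split=> [m|p q Up Uq m|a p Up m]; rewrite ?msupp0 //.
  by move=> /msuppD_le; rewrite mem_cat => /orP[/Up|/Uq].
move=> /msuppM_le /allpairsP[[m1 m2] /= [_ /Up Um2 ->]].
by apply: upU Um2; apply: lem_addl.
Qed.

Lemma monidX U m : monid U 'X_[m] <-> U m.
Proof.
split=> [|Um m']; first by apply; rewrite msuppX inE.
by rewrite msuppX inE => /eqP ->.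
Qed.

Lemma monid_trunc U : trunc_closed (monid U).
Proof. by move=> E p Up m /msupp_mtrunc /Up. Qed.

(* [monid (varU G)] is the prime ideal generated by the variables outside [G]. *)
Definition varU G : 'X_{1..n} -> Prop := fun m => exists2 i, i \notin G & m i != 0%N.

Lemma varU_upset G : upset (varU G).
Proof.
move=> m m' /mnm_lepP mm' [i Gi mi]; exists i => //.
by rewrite -lt0n; apply: leq_trans (mm' i); rewrite lt0n.
Qed.

Definition restr_tuple G : n.-tuple S := [tuple if i \in G then 'X_i else 0 | i < n].

(** As the kernel of a ring morphism into a domain, the ideal is prime. *)
Lemma restr_monid G p : p \mPo restr_tuple G = 0 <-> monid (varU G) p.
Proof.
pose inG (m : 'X_{1..n}) := [forall i, (m i != 0%N) ==> (i \in G)].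
pose g := mlin (fun m => if inG m then 'X_[m] else 0 : S).
have -> : p \mPo restr_tuple G = g p.
  apply: (eq_mlinear (f := comp_mpoly (restr_tuple G)) (g := g)) => m /=.
  rewrite comp_mpolyX /g mlinX; case: ifP => [/forallP mG|/negbT]; last first.
    case/forallPn => i; rewrite negb_imply => /andP[mi Gi].
    by rewrite (bigD1 i) //= tnth_mktuple (negbTE Gi) expr0n (negbTE mi) mul0r.
  rewrite [RHS]mpolyXE_id; apply: eq_bigr => i _; rewrite tnth_mktuple.
  by case: (eqVneq (m i) 0%N) (mG i) => [->|_ /= ->]; rewrite ?expr0.
split=> [g0 m mp|Up].
  have [mG|] := boolP (inG m).
    have := mcoeff_mlin_inj p (g := id) (P := inG) (in2W (@inj_id _)) mG.
    by rewrite -/g -/(g p) g0 mcoeff0 => /esym/eqP; rewrite mcoeff_eq0 mp.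
  case/forallPn => i; rewrite negb_imply => /andP[mi Gi].
  by exists i.
rewrite /g /mlin big1_seq // => m /= /Up [i Gi mi].
case: ifP => [/forallP/(_ i)|]; last by rewrite scaler0.
by rewrite mi (negbTE Gi).
Qed.

Lemma varU_prime G : prime_ideal (monid (varU G)).
Proof.
split; first exact: monid_ideal (@varU_upset G).
  by move/restr_monid/eqP; rewrite comp_mpoly1 oner_eq0.
move=> p q /restr_monid; rewrite rmorphM => /eqP; rewrite mulf_eq0.
by case/orP => /eqP h; [left | right]; apply/restr_monid.
Qed.

(** Each step drops one element of [F] and so adjoins one variable; the chain leads from
    [monid (varU F)] to the ideal of all variables. *)
Lemma varU_chain F :
  prime_chain #|F| (fun j => monid (varU [set i in drop j (enum F)]%SET)).
Proof.
split=> j jF; first exact: varU_prime.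
have sF : (j < size (enum F))%N by rewrite -cardE.
have [i0 _] : exists i, i \in F by apply/card_gt0P; apply: leq_ltn_trans jF.
have dropE := drop_nth i0 sF; set e := nth i0 _ _ in dropE.
split=> [p Up m mp|PS].
  case: (Up m mp) => i; rewrite inE dropE inE negb_or => /andP[_ Fi] mi.
  by exists i; rewrite ?inE.
have : monid (varU [set i in drop j.+1 (enum F)]%SET) 'X_e.
  apply/monidX; exists e; last by rewrite mnm1E eqxx.
  by rewrite inE; have := drop_uniq j (enum_uniq F); rewrite dropE => /andP[].
move/PS/monidX => [j']; rewrite inE dropE mnm1E => Fj.
by rewrite eqb0 negbK => /eqP ej; rewrite ej mem_head in Fj.
Qed.

Definition maxid : set S := monid (varU finset.set0).

Lemma maxid_maximal : maximal_ideal maxid.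
Proof.
have [iM M1 _] := varU_prime finset.set0; split=> // J iJ J1 MJ.
apply/seteqP; split=> // p Jp; apply: contrapT => nMp.
have p0 : p@_0%MM != 0.
  apply: contra_notN nMp => /eqP p0 m mp.
  have m0 : m != 0%MM by apply: contraTneq mp => ->; rewrite mcoeff_msupp p0 eqxx.
  apply: contrapT => noi; case/eqP: m0; apply/mnmP => i; rewrite mnm0E.
  by apply/eqP; apply: contrapT => /negP mi; apply: noi; exists i; rewrite ?inE.
apply: J1; have -> : 1 = (p@_0%MM)^-1%:MP * (p@_0%MM)%:MP :> S.
  by rewrite -mpolyCM mulVf ?mpolyC1.
apply: idealM => //; apply: (idealBr iJ (x := p)) => //; apply: MJ => m.
rewrite mcoeff_msupp mcoeffB mcoeffC => mp; apply: contrapT => noi.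
have m0 : m = 0%MM.
  apply/mnmP => i; rewrite mnm0E.
  by apply/eqP; apply: contrapT => /negP mi; apply: noi; exists i; rewrite ?inE.
by rewrite m0 eqxx mulr1 subrr eqxx in mp.
Qed.

(** The elementary symmetric polynomial of degree [j] in the ['X_i ^+ N]. *)
Definition esymN N j : S := \sum_(h : {set 'I_n} | #|h| == j) 'X_[(mesym1 h *+ N)%MM].

Definition esyms N D : seq S := [seq esymN N j.+1 | j <- iota 0 D].

Lemma size_esyms N D : size (esyms N D) = D.
Proof. by rewrite size_map size_iota. Qed.

Lemma nth_esyms N D i : (i < D)%N -> (esyms N D)`_i = esymN N i.+1.
Proof. by move=> iD; rewrite (nth_map 0%N) ?size_iota // nth_iota. Qed.

Lemma esymN_homog N j : esymN N j \is (j * N).-homog.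
Proof.
apply: rpred_sum => h /eqP hj.
by rewrite dhomogX /= mdegMn mdeg_mesym1 hj.
Qed.

(* If [F] is the set of variables outside [P], then the elementary symmetric
   polynomial of degree [#|F|] is congruent to [\prod_(i in F) 'X_i ^+ N]. *)
Lemma prime_esyms N D (P : set S) : (0 < N)%N -> prime_ideal P ->
  (forall G, (D < #|G|)%N -> P 'X_[(mesym1 G *+ N)%MM]) ->
  (forall a, a \in esyms N D -> P a) -> forall i, P 'X_i.
Proof.
move=> N0 pP big PE i; apply: contrapT => nPi.
have [iP _ _] := pP.
pose F : {set 'I_n} := [set j | `[< ~ P 'X_j >]]%SET.
have nPF : ~ P 'X_[(mesym1 F *+ N)%MM].
  move/(prime_monomial _ pP) => [j]; rewrite mulmnE mnmE inE.
  by case: asboolP.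
have F0 : (0 < #|F|)%N by apply/card_gt0P; exists i; rewrite inE; apply/asboolP.
have [FD|/big//] := leqP #|F| D.
have : P (esymN N #|F|).
  apply: PE; apply/mapP; exists #|F|.-1; first by rewrite mem_iota; lia.
  by rewrite prednK.
rewrite /esymN (bigD1 F) //= => PF; apply: nPF.
set B := (X in _ + X) in PF.
have PB : P B.
  apply: ideal_sum => // h /andP[/eqP hF neq].
  have : ~~ (h \subset F).
    by apply: contra neq => hsub; rewrite eqEcard hsub hF leqnn.
  case/subsetPn => j jh jF; apply/(prime_monomial _ pP); exists j.
    by rewrite mulmnE mnmE jh mul1n -lt0n.
  by apply: contrapT => nPj; move: jF; rewrite inE => /asboolP.
by have := idealB iP PF PB; rewrite addrK.
Qed.

(** A prime containing [K] contains every variable by [prime_esyms], hence [a]; so [K] cannot miss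
    all powers of [a]. *)
Lemma esyms_radical N D (K : set S) a : (0 < N)%N -> is_ideal K ->
  (forall G, (D < #|G|)%N -> K 'X_[(mesym1 G *+ N)%MM]) ->
  (forall a, a \in esyms N D -> K a) -> maxid a -> exists M, K (a ^+ M).
Proof.
move=> N0 iK big KE ma; apply: contrapT => noM.
pose T : set S := [set x | exists M, x = a ^+ M].
have [|x y|x Kx|P [pP KP PT]] := @prime_avoiding _ K T iK.
- by exists 0%N.
- by move=> [u ->] [v ->]; exists (u + v)%N; rewrite exprD.
- by move=> [u xu]; apply: noM; exists u; rewrite -xu.
have PX : forall i, P 'X_i.
  apply: (prime_esyms (N := N) (D := D)) => // [G /big|b /KE]; exact: KP.
apply: (PT a); last by exists 1%N.
apply: monomial_sum_in => [|m am]; first by case: pP.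
have [i _ mi] := ma m am.
by apply/(prime_monomial _ pP); exists i.
Qed.

End MonomialIdeals.

(** * The Cohen-Macaulay criterion *)

Lemma img_maximal (S : comPzRingType) (G K : set S) :
  maximal_ideal K -> ideal_gen G `<=` K -> maximal_ideal (@img S G K).
Proof.
move=> mK JK; have [iK K1 maxK] := mK; split.
- exact: img_ideal.
- by rewrite -(qpi1 G) => /(imgE _ iK JK).
- move=> L iL L1 KL; rewrite -[LHS]img_pre; congr (@img _ G _).
  apply: maxK; first exact: pre_ideal.
    by rewrite /pre /= qpi1.
  by move=> x Kx; apply: KL; apply/imgE.
Qed.

Section Criterion.
Variables (k : fieldType) (n : nat) (G0 : set {mpoly k[n]}).
Variables (U : 'X_{1..n} -> Prop) (N D : nat).
Local Notation S := {mpoly k[n]}.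
Hypothesis upU : upset U.
Hypothesis genU : ideal_gen G0 = monid U.
Hypothesis N0 : (0 < N)%N.
(** The two hypotheses pin the dimension of the quotient to [D]: from above by products of powers of
    variables in the ideal, from below by a coordinate subspace on which the ideal vanishes. *)
Hypothesis faces_le : forall G : {set 'I_n}, (D < #|G|)%N -> U (mesym1 G *+ N)%MM.
Hypothesis face_dim : exists2 F : {set 'I_n}, #|F| = D & forall m, U m -> varU F m.

Let J : set S := monid U.
Let iJ : is_ideal J. Proof. exact: monid_ideal. Qed.
Let th := esyms k n N D.

Lemma tr_homog_homog (a : S) e : (0 < e)%N -> a \is e.-homog ->
  tr_homog (@mtrunc k n) a e.
Proof. by move=> e0 ha; split=> // E x; apply: mtrunc_homogM. Qed.

(** By depth sensitivity the regularity of [s] makes the Koszul homology on [t] vanish in positive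
    degrees, and the graded Nakayama lemma turns this into regularity of [t]. *)
Lemma wreg_homog (s t : seq S) :
  (forall a, a \in t -> exists2 e, (0 < e)%N & a \is e.-homog) ->
  wreg J s -> size s = size t ->
  (forall a, a \in s -> exists M, idl J t (a ^+ M)) -> wreg J t.
Proof.
move=> ht rs st radt; rewrite -[t]revK.
apply: (@kacyclic_wreg _ _ iJ (@mtrunc k n)).
- by move=> E x y; rewrite raddfD.
- exact: mtrunc0.
- by move=> E x; apply: monid_trunc.
- by move=> x; exists (msize x) => E; apply: mtrunc_id.
- move=> a; rewrite mem_rev => /ht[e e0 ae]; exists e; exact: tr_homog_homog.
apply: (wreg_kacyclic iJ rs); last by rewrite size_rev add1n st.
move=> a /radt[M JM]; exists M.
by rewrite (eq_idl iJ (mem_rev t)).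
Qed.

Lemma face_chain : exists P : nat -> set S,
  [/\ prime_chain D P, P D = @maxid k n & J `<=` P 0%N].
Proof.
have [F FD UF] := face_dim.
exists (fun j => monid (varU [set i in drop j (enum F)]%SET)); split.
- by rewrite -FD; apply: varU_chain.
- rewrite /maxid; congr (monid (varU _)); apply/setP => i.
  by rewrite drop_oversize ?inE // -cardE FD.
- move=> p Jp m /Jp /UF [i Fi mi]; exists i => //.
  by rewrite drop0 inE mem_enum.
Qed.

Lemma J_sub_maxid : J `<=` @maxid k n.
Proof.
by have [F FD UF] := face_dim => p Jp m /Jp /UF [i Fi mi]; exists i; rewrite ?inE.
Qed.

(** The product of the [N]-th powers of the variables outside [P 0%N] is not in this prime, so by
    [faces_le] there are at most [D] of them. *)
Lemma chain_le l (P : nat -> set S) : prime_chain l P -> J `<=` P 0%N -> (l <= D)%N.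
Proof.
move=> cP JP; have := prime_chain_le cP; set F := finset _ => lF.
have p0 := (proj1 cP) 0%N isT.
apply: leq_trans lF _; rewrite leqNgt; apply/negP => /faces_le.
move/(monidX k) => /JP /(prime_monomial _ p0) [i ].
by rewrite mulmnE mnmE inE; case: asboolP.
Qed.

Lemma crit_dim : has_krull_dim (qring G0) D.
Proof.
split=> [|l P cP].
  have [P [cP _ JP]] := face_chain.
  by exists (fun i => @img _ G0 (P i)); apply: img_chain; rewrite ?genU.
apply: (chain_le (pre_chain cP)).
rewrite -[J]genU; apply: sub_pre.
by have [/(_ 0%N isT)[]] := cP.
Qed.

(** The ideal of the variables has codimension at least [D], so it contains a regular sequence of at
    least that length, whose elements have powers in [J + (th)]. *)
Lemma crit_wreg : cohen_macaulay (qring G0) -> wreg J th.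
Proof.
move=> CM; have [|c [_ codim_c] [[s [rs sQ ss]] _]] := CM (@img _ G0 (@maxid k n)).
  by apply: img_maximal; [apply: maxid_maximal | rewrite genU; apply: J_sub_maxid].
have Dc : (D <= c)%N.
  have [P [cP PD JP]] := face_chain.
  by apply: (codim_c D (fun i => @img _ G0 (P i))); rewrite ?PD //; apply: img_chain; rewrite ?genU.
have [s' def_s] := seq_qpi s; rewrite {s}def_s in rs sQ ss.
have [] := (regular_seq_qpi G0 s').1 rs; rewrite genU -/J => rs' _.
have iM := prime_ideal_ideal (maximal_ideal_prime (@maxid_maximal k n)).
have sM a : a \in s' -> @maxid k n a.
  move=> sa; apply/(imgE (G := G0) a iM); first by rewrite genU; apply: J_sub_maxid.
  by apply: sQ; apply: map_f.
rewrite size_map in ss.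
apply: (@wreg_homog (take D s')).
- move=> a /mapP[j _ ->]; exists (j.+1 * N)%N; first by rewrite muln_gt0.
  exact: esymN_homog.
- exact: wreg_take.
- by rewrite size_take_min size_esyms ss; apply/minn_idPl.
- move=> a /mem_take /sM; apply: (esyms_radical (N := N) (D := D)) => //.
  + exact: idl_ideal.
  + by move=> G /faces_le; move/(monidX k); apply: sub_idl.
  + by move=> b; apply: mem_idl.
Qed.

Lemma crit_cm : wreg J th -> cohen_macaulay (qring G0).
Proof.
move=> rth Q mQ; have mQ' := pre_maximal mQ; set Q' := pre Q in mQ'.
have pQ := maximal_ideal_prime mQ; have pQ' := maximal_ideal_prime mQ'.
have [iQ' Q'1 _] := pQ'.
have JQ' : J `<=` Q' by rewrite -[J]genU; apply: sub_pre; case: pQ.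
have [q qP] : exists q : S -> {poly k}, forall f, q f \is monic /\
    Q' (map_poly (@mpolyC n k) (q f)).[f].
  suff /choice[q qP] : forall f, exists p : {poly k}, p \is monic /\
    Q' (map_poly (@mpolyC n k) p).[f] by exists q.
  by move=> f; have [p mp Qp] := maximal_ideal_algebraic f mQ'; exists p.
(* For [f] homogeneous of positive degree, [phi f] is an element of [Q'] with leading form
   [psi f]. *)
pose phi f := (map_poly (@mpolyC n k) (q f)).[f].
pose psi f := f ^+ (size (q f)).-1.
have q0 f : (1 < size (q f))%N.
  have [mf Qf] := qP f; rewrite ltnNge; apply/negP => sq; apply: Q'1.
  have q1 : q f = 1.
    have := monicP mf; rewrite [q f]size1_polyC ?lead_coefC; last by [].
    by move=> ->.
  by move: Qf; rewrite q1 rmorph1 hornerE.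
have hth f : f \in th -> exists2 e, (0 < e)%N & f \is e.-homog.
  move=> /mapP[j _ ->]; exists (j.+1 * N)%N; first by rewrite muln_gt0.
  exact: esymN_homog.
have rpsi : wreg J (map psi th).
  apply: (wreg_homog _ rth); rewrite ?size_map //.
    move=> _ /mapP[f /hth[e e0 fe] ->]; exists (e * (size (q f)).-1)%N.
      by rewrite muln_gt0 e0 -subn1 subn_gt0 q0.
    exact: dhomogMn.
  move=> f fth; exists (size (q f)).-1; apply: mem_idl => //.
  exact: (map_f psi).
have rphi : wreg J (map phi th).
  apply: (wreg_leading iJ iJ (@monid_trunc _ _ U) (@leading_refl _ _ J)) rpsi.
    by rewrite !size_map.
  rewrite size_map => i ith; rewrite (nth_map 0 0 psi) // (nth_map 0 0 phi) //.
  set f := th`_i; have /hth[e e0 fe] : f \in th by apply: mem_nth.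
  exists (e * (size (q f)).-1)%N; split; first exact: dhomogMn.
  have [mf _] := qP f; have := q0 f.
  rewrite /phi /psi horner_coef size_map_poly.
  case def_d: (size (q f)) => [//|d] /= d0.
  rewrite big_ord_recr /= coef_map /=.
  have := monicP mf; rewrite /lead_coef def_d /= => ->; rewrite mul1r addrK.
  apply: (big_ind (fun p : S => (msize p <= e * d)%N)) => [|p p'|j _].
  - by rewrite msize0.
  - exact: msizeD_ub.
  - rewrite coef_map /= mul_mpolyC; apply: leq_trans (msizeZ_le _ _) _.
    apply: leq_trans (msize_expr_le _ (msize_homog fe)) _.
    by have := ltn_ord j; rewrite -(leq_pmul2l e0) mulnS mulnC; lia.
have phiQ a : a \in map phi th -> Q' a by move=> /mapP[f _ ->]; case: (qP f).
have sphi : size (map phi th) = D by rewrite size_map size_esyms.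
(* Regular sequences in [Q] give chains of primes ending at [Q], so their lengths are at most [D];
   the [phi f] attain [D], which is thus both codimension and depth. *)
have codim s : regular_seq s -> [set` s] `<=` Q ->
    exists2 P, prime_chain (size s) P & P (size s) = Q.
  have [s' ->] := seq_qpi s => rs sQ.
  have [] := (regular_seq_qpi G0 s').1 rs; rewrite genU -/J => rs' _.
  have [|P [cP Ps JP]] := wreg_prime_chain iJ pQ' rs'.
    apply: idl_min => // a sa; apply: sQ; exact: map_f.
  rewrite size_map; exists (fun i => @img _ G0 (P i)).
    by apply: img_chain; rewrite ?genU.
  by rewrite Ps img_pre.
have codim_le l (P : nat -> set (qring G0)) : prime_chain l P -> (l <= D)%N.
  by move=> cP; apply: (proj2 crit_dim) cP.
have rQ : regular_seq (map (qpi G0) (map phi th)).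
  apply/regular_seq_qpi; rewrite genU; split=> // s1; apply: Q'1.
  exact: (idl_min iQ' JQ' phiQ).
have sQ : [set` map (qpi G0) (map phi th)] `<=` Q.
  by move=> _ /= /mapP[a /phiQ Qa ->].
exists D; split.
- by have [P cP PQ] := codim _ rQ sQ; rewrite size_map sphi in cP PQ; exists P.
- by move=> l P cP _; apply: codim_le cP.
- by exists (map (qpi G0) (map phi th)); split=> //; rewrite size_map sphi.
- by move=> s rs sQ'; have [P cP _] := codim s rs sQ'; apply: codim_le cP.
Qed.

End Criterion.

(** * Restriction of scalars to the N-th powers *)

(* The polynomial ring is free over its subring of polynomials in the N-th powers
   of the variables, with the monomials of exponents less than N as a basis. *)
Section Residues.
Variables (k : fieldType) (n N : nat).
Local Notation S := {mpoly k[n]}.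
Local Notation box := {ffun 'I_n -> 'I_N}.
Implicit Types (p q f g : S) (b : box) (m : 'X_{1..n}).
Hypothesis N0 : (0 < N)%N.

Definition mshift b m : 'X_{1..n} := [multinom (b i + m i * N)%N | i < n].

Definition mquo m : 'X_{1..n} := [multinom (m i %/ N)%N | i < n].

Definition mres b m : bool := [forall i, (m i %% N)%N == b i].

(** The substitution of ['X_i ^+ N] for ['X_i], which identifies [S] with the subring of scalars. *)
Definition frob : S -> S := mlin (fun m => 'X_[(m *+ N)%MM]).

(** The coordinate along the basis monomial of exponent [b]; [comp_out b] is the inclusion of this
    summand. *)
Definition comp_in b : S -> S := mlin (fun m => if mres b m then 'X_[mquo m] else 0).

Definition comp_out b : S -> S := mlin (fun m => 'X_[mshift b m]).

HB.instance Definition _ := GRing.Linear.on frob.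
HB.instance Definition _ b := GRing.Linear.on (comp_in b).
HB.instance Definition _ b := GRing.Linear.on (comp_out b).

Lemma mresP b m : mres b m -> m = mshift b (mquo m).
Proof.
move/forallP => mb; apply/mnmP => i; rewrite !mnmE -(eqP (mb i)) addnC.
exact: divn_eq.
Qed.

Lemma mquo_mshift b m : mquo (mshift b m) = m.
Proof. by apply/mnmP => i; rewrite !mnmE addnC divnMDl // divn_small // addn0. Qed.

Lemma mres_mshift b b' m : mres b' (mshift b m) = (b' == b).
Proof.
apply/forallP/eqP => [h|-> i]; last by rewrite mnmE addnC modnMDl modn_small.
apply/ffunP => i; apply: val_inj; have := h i.
by rewrite mnmE addnC modnMDl modn_small // => /eqP.
Qed.

Lemma comp_out_inK b b' p : comp_in b' (comp_out b p) = if b' == b then p else 0.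
Proof.
rewrite [p in RHS](mpolyE p) /comp_out {1}/mlin linear_sum /=.
case: eqP => [->|/eqP ne]; last first.
  apply: big1 => m _; rewrite linearZ /= /comp_in mlinX mres_mshift.
  by rewrite (negbTE ne) scaler0.
apply: eq_bigr => m _; rewrite linearZ /= /comp_in mlinX mres_mshift eqxx.
by rewrite mquo_mshift.
Qed.

Lemma comp_inM b g f : comp_in b (frob g * f) = g * comp_in b f.
Proof.
rewrite [g in RHS](mpolyE g) /frob {1}/mlin !mulr_suml linear_sum.
apply: eq_bigr => m _; rewrite -!scalerAl linearZ /=; congr (_ *: _).
rewrite (mpolyE f) mulr_sumr !linear_sum mulr_sumr; apply: eq_bigr => m' _ /=.
rewrite -scalerAr !linearZ /= -scalerAr; congr (_ *: _).
rewrite -mpolyXD /comp_in !mlinX.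
have -> : mres b (m *+ N + m')%MM = mres b m'.
  by apply: eq_forallb => i; rewrite mnmDE mulmnE modnMDl.
case: ifP => _; last by rewrite mulr0.
rewrite -mpolyXD; congr 'X_[_]; apply/mnmP => i.
by rewrite !mnmE mulmnE divnMDl.
Qed.

Lemma mcoeff_comp_in b p m : (comp_in b p)@_m = p@_(mshift b m).
Proof.
rewrite -{1}[m](mquo_mshift b).
apply: (mcoeff_mlin_inj (g := mquo) (P := mres b)); last by rewrite mres_mshift.
by move=> m1 m2 /mresP e1 /mresP e2 e; rewrite e1 e2 e.
Qed.

Lemma monid_comp_in (U : 'X_{1..n} -> Prop) f :
  monid U f <-> forall b, monid (fun m => U (mshift b m)) (comp_in b f).
Proof.
split=> [Uf b m|Uf m mf].
  by rewrite mcoeff_msupp mcoeff_comp_in -mcoeff_msupp => /Uf.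
pose b : box := [ffun i => Ordinal (ltn_pmod (m i) N0)].
have mb : mres b m by apply/forallP => i; rewrite ffunE.
rewrite (mresP mb); apply: (Uf b).
by rewrite mcoeff_msupp mcoeff_comp_in -(mresP mb) -mcoeff_msupp.
Qed.

Lemma wreg_frob (J : set S) (Jb : box -> set S) s :
  (forall b, is_ideal (Jb b)) -> (forall f, J f <-> forall b, Jb b (comp_in b f)) ->
  wreg J (map frob s) <-> forall b, wreg (Jb b) s.
Proof.
elim: s J Jb => [|g s IHs] J Jb iJb JE //=.
have adjE f : adj J (frob g) f <-> forall b, adj (Jb b) g (comp_in b f).
  split=> [[c /JE Jc] b|/choice[c Jc]].
    by exists (comp_in b c); have := Jc b; rewrite raddfB /= mulrC comp_inM mulrC.
  exists (\sum_b comp_out b (c b)); apply/JE => b.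
  rewrite raddfB /= mulrC comp_inM mulrC linear_sum (bigD1 b) //= comp_out_inK eqxx.
  rewrite big1 ?addr0 // => b' b'b; rewrite comp_out_inK eq_sym (negbTE b'b).
  by [].
have {}IHs := IHs _ _ (fun b => adj_ideal g (iJb b)) adjE.
have regE : (forall y, J (frob g * y) -> J y) <->
    forall b y, Jb b (g * y) -> Jb b y.
  split=> [reg b y Jy|reg y /JE Jy].
    have /JE/(_ b) : J (comp_out b y).
      apply: reg; apply/JE => b'; rewrite comp_inM comp_out_inK.
      by case: eqP => [->|_] //; rewrite mulr0; apply: ideal0.
    by rewrite comp_out_inK eqxx.
  by apply/JE => b; apply: reg; rewrite -comp_inM; apply: Jy.
split=> [[/regE reg /IHs regs] b|reg].
  by split; [apply: reg | apply: regs].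
by split; [apply/regE => b; case: (reg b) | apply/IHs => b; case: (reg b)].
Qed.

Lemma frob_esyms D : map frob (esyms k n 1 D) = esyms k n N D.
Proof.
rewrite -map_comp; apply: eq_map => j /=; rewrite /esymN linear_sum.
by apply: eq_bigr => h _; rewrite /= /frob mlinX mulm1n.
Qed.

End Residues.

(** * The distracting arrangement *)

(** Beyond the last chosen position, a position is chosen where the remaining tail attains its
    minimum. *)
Lemma nondecreasing_subseq (h : nat -> nat) : exists g : nat -> nat,
  {homo g : a b / (a < b)%N} /\ {homo (h \o g) : a b / (a <= b)%N}.
Proof.
have /choice[mu muP] M : exists j, (M <= j)%N /\ forall l, (M <= l)%N -> (h j <= h l)%N.
  have exv : exists v, `[< exists2 j, (M <= j)%N & h j = v >].
    by exists (h M); apply/asboolP; exists M.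
  case: (ex_minnP exv) => v /asboolP[j Mj <-] vmin.
  by exists j; split=> // l Ml; apply: vmin; apply/asboolP; exists l.
pose g := fix g a := if a is a'.+1 then mu (g a').+1 else mu 0%N.
have gS a : (g a < g a.+1)%N by case: (muP (g a).+1).
exists g; split; first exact: homo_ltn ltn_trans gS.
apply: homo_leq => [a|b a c|a] /=; [exact: leqnn|exact: leq_trans|].
case: a => [|a] /=; first by have [_] := muP 0%N; apply.
by have [_] := muP (g a).+1; apply; apply: leq_trans (ltnW (gS a.+1)).
Qed.

Lemma nondecreasing_subseq_mnm n (f : nat -> 'X_{1..n}) (s : seq 'I_n) :
  exists g : nat -> nat, {homo g : a b / (a < b)%N} /\
    forall i, i \in s -> {homo (fun a => f (g a) i) : a b / (a <= b)%N}.
Proof.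
elim: s => [|i0 s [g [gI gs]]]; first by exists id; split.
have [g' [g'I g's]] := nondecreasing_subseq (fun a => f (g a) i0).
exists (g \o g'); split=> [a b /g'I /gI //|i].
rewrite inE => /predU1P[->|/gs h] a b ab; first exact: g's.
apply: h; move: ab; rewrite leq_eqVlt => /predU1P[->//|/g'I].
exact: ltnW.
Qed.

(** Dickson's lemma, as a bound on the exponents of minimal generators: a sequence of
    counterexamples would have a subsequence nondecreasing in every coordinate. *)
Lemma dickson n (U : 'X_{1..n} -> Prop) : upset U ->
  exists N, (0 < N)%N /\ forall m, U m -> U [multinom minn (m i) N | i < n].
Proof.
move=> upU; apply: contrapT => noN.
have /choice[f fP] M : exists m, U m /\ ~ U [multinom minn (m i) M.+1 | i < n].
  apply: contrapT => nom; apply: noN; exists M.+1; split=> // m Um.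
  by apply: contrapT => nU; apply: nom; exists m.
have [g [gI gs]] := nondecreasing_subseq_mnm f (enum 'I_n).
(* The exponents of [f (g 0%N)] are at most [j <= g j], so they stay below those of [f (g j)] cut
   off at [(g j).+1]. *)
pose j := mdeg (f (g 0%N)).
have jg : (j <= g j)%N.
  by elim: (j) => // a IHa; apply: leq_ltn_trans IHa _; apply: gI.
have [_ nU] := fP (g j); apply: nU; have [Ug0 _] := fP (g 0%N).
apply: upU Ug0; apply/mnm_lepP => i; rewrite mnmE leq_min.
rewrite (gs i) ?mem_enum //=; apply: leqW; apply: leq_trans jg.
by rewrite /j mdegE (bigD1 i) //= leq_addr.
Qed.

Section Arrangement.
Variables (C : numFieldType) (n : nat) (U : 'X_{1..n} -> Prop).
Hypothesis upU : upset U.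
Implicit Types (a v w : 'rV[C]_n) (F : {set 'I_n}).

Definition lattice_points : set 'rV[C]_n :=
  [set \row_i (m i)%:R | m in [set m : 'X_{1..n} | ~ U m]].

Local Notation V := (zariski_closure lattice_points).

Definition nat_below (x : C) (e : nat) := exists2 j, (j < e)%N & x = j%:R.

(** Combinatorial form of the inclusion of [flat a F] in the arrangement: for each monomial [m] of
    the ideal, the product of the ['X_i - j] with [j < m i] has a factor vanishing on the flat. *)
Definition is_face a F :=
  forall m, U m -> exists2 i, i \notin F & nat_below (a 0 i) (m i).

Definition flat a F : set 'rV[C]_n := [set v | forall i, i \notin F -> v 0 i = a 0 i].

Lemma poly_nat_eq0 (q : {poly C}) N : (forall j, (N <= j)%N -> q.[j%:R] = 0) -> q = 0.
Proof.
move=> q0; apply/eqP; apply: contraT => nz.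
have := max_poly_roots (rs := [seq j%:R | j <- iota N (size q)]) nz.
rewrite size_map size_iota ltnn; apply.
  apply/allP => x /mapP[j]; rewrite mem_iota => /andP[Nj _] ->.
  by rewrite /root q0.
by rewrite map_inj_uniq ?iota_uniq // => j l /eqP; rewrite eqr_nat => /eqP.
Qed.

Lemma horner_curve (p : {mpoly C[n]}) (L : 'I_n -> {poly C}) t :
  (mmap (@polyC C) L p).[t] = p.@[fun i => (L i).[t]].
Proof.
rewrite -[LHS]/(horner_eval t _) rmorph_mmap; apply: eq_mmap => // c /=.
by rewrite /horner_eval hornerC.
Qed.

(** The product [p] of the ['X_i - j] with [j < m i] vanishes at all the lattice points, since an
    exponent outside [U] has an entry below that of [m]. *)
Lemma closure_is_face v : V v -> is_face v finset.set0.
Proof.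
move=> Vv m Um; apply: contrapT => noi.
pose p : {mpoly C[n]} := \prod_i \prod_(j < m i) ('X_i - (j%:R)%:MP).
have pE w : p.@[w 0] = \prod_i \prod_(j < m i) (w 0 i - j%:R).
  rewrite rmorph_prod; apply: eq_bigr => i _; rewrite rmorph_prod.
  by apply: eq_bigr => j _; rewrite rmorphB /= mevalXU mevalC.
pose Z := [set w : 'rV[C]_n | forall q : {mpoly C[n]}, q = p -> q.@[w 0] = 0].
have : Z v.
  apply: (Vv Z); first by exists [set p].
  move=> _ [m' nUm' <-] q ->; rewrite pE.
  have [i mi] : exists i, (m' i < m i)%N.
    apply: contrapT => noi'; apply: nUm'; apply: upU Um; apply/mnm_lepP => i.
    by rewrite leqNgt; apply/negP => lt; apply: noi'; exists i.
  rewrite (bigD1 i) //= (bigD1 (Ordinal mi)) //= mxE subrr mul0r mul0r.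
  by [].
move=> /(_ p erefl)/eqP; rewrite pE.
case/prodf_eq0 => i _ /prodf_eq0[j _]; rewrite subr_eq0 => /eqP vj.
by apply: noi; exists i; rewrite ?inE //; exists j.
Qed.

(** Replacing the coordinates of [v] outside [{0, ..., N - 1}] by integers at least [N] gives
    lattice points, where [p] vanishes. In [claim] the coordinates in [s] are free; they are freed
    one by one, as a polynomial in one variable with infinitely many roots is zero. *)
Lemma face_closure v : is_face v finset.set0 -> V v.
Proof.
have [N [N0 UN]] := dickson upU.
move=> fv Z [E ->] LE p Ep.
pose big i := forall j, (j < N)%N -> v 0 i <> j%:R.
pose H (w : 'I_n -> C) i := exists j, w i = j%:R /\
  (v 0 i = j%:R \/ (N <= j)%N /\ big i).
suff claim (s : seq 'I_n) (w : 'I_n -> C) : (forall i, i \notin s -> H w i) ->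
    (forall i, i \in s -> big i) -> p.@[w] = 0.
  apply: (claim [seq i <- enum 'I_n | `[< big i >]]) => i; last first.
    by rewrite mem_filter => /andP[/asboolP].
  rewrite mem_filter mem_enum andbT => /asboolP/existsNP[j].
  by move=> /not_implyP[jN /contrapT vj]; exists j; split=> //; left.
elim: s w => [|i0 s IHs] w Hw bigs.
  have [m wm] : exists m : 'X_{1..n}, forall i, w i = (m i)%:R /\
      (v 0 i = (m i)%:R \/ (N <= m i)%N /\ big i).
    have /choice[m mP] i := Hw i isT.
    by exists [multinom m i | i < n] => i; rewrite mnmE.
  have : lattice_points (\row_i (m i)%:R).
    exists m => //= Um; have [i _ [j]] := fv _ (UN m Um).
    rewrite mnmE leq_min => /andP[jm jN] vj.
    have [_ [vm|[_ /(_ j jN)//]]] := wm i.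
    by move: jm; rewrite vj in vm; move/eqP: vm; rewrite eqr_nat => /eqP ->; rewrite ltnn.
  move/LE/(_ p Ep) => <-; apply: meval_eq => i.
  by rewrite mxE; case: (wm i).
have [s0|s0] := boolP (i0 \in s).
  apply: IHs => i si; last by apply: bigs; rewrite inE si orbT.
  by apply: Hw; rewrite inE negb_or si andbT; apply: contraNneq si => ->.
pose L i := if i == i0 then 'X else (w i)%:P.
have q0 : mmap (@polyC C) L p = 0.
  apply: (@poly_nat_eq0 _ N) => j Nj; rewrite horner_curve; apply: IHs => i si.
    have [ii0|ne] := eqVneq i i0.
      exists j; rewrite /L ii0 eqxx hornerX; split=> //; right; split=> //.
      by apply: bigs; rewrite mem_head.
    have [|l [wl Hl]] := Hw i; first by rewrite inE negb_or ne.
    by exists l; rewrite /L (negbTE ne) hornerC.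
  by apply: bigs; rewrite inE si orbT.
have := horner_curve p L (w i0); rewrite q0 horner0 => /esym <-.
apply: meval_eq => i; rewrite /L; case: eqP => [->|_]; first by rewrite hornerX.
by rewrite hornerC.
Qed.

(** The line through a point outside [Z1] and a point outside [Z2] stays in the flat; on it two
    nonzero polynomials would have a product vanishing at all natural numbers. *)
Lemma flat_irreducible a F : zariski_irreducible (flat a F).
Proof.
split=> [|Z1 Z2 [E1 ->] [E2 ->] sub]; first by exists a.
apply: contrapT => /not_orP[n1 n2].
have wit (E : set {mpoly C[n]}) : ~ (flat a F `<=` [set v | forall p, E p -> p.@[v 0] = 0]) ->
    exists v p, [/\ flat a F v, E p & p.@[v 0] != 0].
  move=> nsub; apply: contrapT => no; apply: nsub => v av p Ep.
  by apply/eqP; apply: contrapT => /negP nz; apply: no; exists v, p.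
have [v1 [p1 [av1 E1p nz1]]] := wit _ n1.
have [v2 [p2 [av2 E2p nz2]]] := wit _ n2.
pose L i : {poly C} := (v1 0 i)%:P + (v2 0 i - v1 0 i)%:P * 'X.
pose q1 := mmap (@polyC C) L p1; pose q2 := mmap (@polyC C) L p2.
have q1nz : q1 != 0.
  apply: contraNneq nz1 => q10; have := horner_curve p1 L 0.
  rewrite -/q1 q10 horner0 => /esym/eqP; congr (_ == 0); apply: meval_eq => i.
  by rewrite /L hornerD hornerM !hornerC hornerX mulr0 addr0.
have q2nz : q2 != 0.
  apply: contraNneq nz2 => q20; have := horner_curve p2 L 1.
  rewrite -/q2 q20 horner0 => /esym/eqP; congr (_ == 0); apply: meval_eq => i.
  by rewrite /L hornerD hornerM !hornerC hornerX mulr1 addrC subrK.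
have : q1 * q2 = 0.
  apply: (@poly_nat_eq0 _ 0%N) => j _; rewrite hornerM !horner_curve.
  pose w : 'rV[C]_n := \row_i (L i).[j%:R].
  have aw : flat a F w.
    by move=> i Fi; rewrite mxE /L hornerD hornerM !hornerC (av1 i Fi) (av2 i Fi) subrr mul0r addr0.
  have wE (p : {mpoly C[n]}) : p.@[fun i => (L i).[j%:R]] = p.@[w 0].
    by apply: meval_eq => i; rewrite mxE.
  rewrite !wE; case: (sub w aw) => [/(_ p1 E1p) ->|/(_ p2 E2p) ->].
    by rewrite mul0r.
  by rewrite mulr0.
by move/eqP; rewrite mulf_eq0 (negbTE q1nz) (negbTE q2nz).
Qed.

Lemma irreducible_in_component (A W : set 'rV[C]_n) :
  zariski_irreducible A -> A `<=` W ->
  exists2 B, irreducible_component W B & A `<=` B.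
Proof.
move=> iA AW.
pose good B := [/\ zariski_irreducible B, A `<=` B & B `<=` W].
have [Fm Fgood Ftot|B [Bgood Bmax]] :=
    @Zorn_bigcup _ (fun B => B = classical_sets.set0 \/ good B).
  have [[B FB B0]|noB] := pselect (exists2 B, Fm B & B !=set0); last first.
    left; apply/seteqP; split=> // x [B FB Bx]; case: noB; exists B => //.
    by exists x.
  have gF B' x : Fm B' -> B' x -> good B' by move=> /Fgood[->|].
  have gB : good B by case: B0 => x; apply: gF.
  have [_ AB _] := gB.
  right; split; last first.
  - by move=> x [B' FB' B'x]; have [_ _] := gF _ _ FB' B'x; apply.
  - by move=> x Ax; exists B => //; apply: AB.
  split=> [|Z1 Z2 cZ1 cZ2 sub].
    by have [[x Ax] _] := iA; exists x; exists B => //; apply: AB.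
  apply: contrapT => /not_orP[n1 n2].
  have wit (Z : set 'rV[C]_n) : ~ (\bigcup_(X in Fm) X `<=` Z) -> exists X x, [/\ Fm X, X x & ~ Z x].
    move=> nsub; apply: contrapT => no; apply: nsub => x [X FX Xx].
    by apply: contrapT => nZ; apply: no; exists X, x.
  have [X1 [x1 [FX1 Xx1 nZ1]]] := wit _ n1.
  have [X2 [x2 [FX2 Xx2 nZ2]]] := wit _ n2.
  have [X [FX Xx1' Xx2']] : exists X, [/\ Fm X, X x1 & X x2].
    have [s|s] := Ftot _ _ FX1 FX2.
      by exists X2; split=> //; apply: s.
    by exists X1; split=> //; apply: s.
  have [[_ irr] _ _] := gF _ _ FX Xx1'.
  case: (irr Z1 Z2 cZ1 cZ2) => [x Xx|/(_ _ Xx1')|/(_ _ Xx2')] //.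
  by apply: sub; exists X.
have gB : good B.
  case: Bgood => // B0; exfalso; apply: (Bmax A); last first.
    by right; split=> //; apply: subset_refl.
  have [[x Ax] _] := iA.
  by rewrite B0; split=> [y //|/(_ x Ax)].
have [iB AB BW] := gB; exists B => //; split=> // B' iB' BB' B'W.
apply: contrapT => ne; apply: (Bmax B').
  by split=> // B'B; apply: ne; apply/seteqP.
by right; split=> //; apply: subset_trans AB BB'.
Qed.

Lemma flat_sub_closure a F : flat a F `<=` V <-> is_face a F.
Proof.
split=> [sub m Um|fa v av]; last first.
  apply: face_closure => m Um; have [i Fi ai] := fa m Um.
  by exists i; rewrite ?inE // av.
(* As -1 is not a natural number, the index obtained from [w] lies outside [F]. *)
pose w : 'rV[C]_n := \row_i if i \in F then -1 else a 0 i.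
have /closure_is_face/(_ m Um)[i _ [j jm]] : V w.
  by apply: sub => i Fi; rewrite mxE (negbTE Fi).
rewrite mxE; case: ifP => [_|/negbT Fi aj]; last by exists i => //; exists j.
by move/eqP; rewrite eq_sym -subr_eq0 opprK natr1 pnatr_eq0.
Qed.

(** Being irreducible, a flat in the arrangement lies in a single component, which passes through
    [a]. *)
Lemma exponent_complexP a F : F \in exponent_complex V a <-> is_face a F.
Proof.
rewrite inE; split=> [/asboolP sub|fa].
  apply/flat_sub_closure => v av.
  have [|z [B [[BV _ _] Ba] Bz] zv] := sub (v - a).
    by move=> i Fi; rewrite !mxE (av i Fi) subrr.
  by move/addIr: zv => <-; apply: BV.
apply/asboolP => v Fv; exists (v + a); last by rewrite addrK.
have [B cB aB] := irreducible_in_component (flat_irreducible a F) ((flat_sub_closure a F).2 fa).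
exists B; first by split=> //; apply: aB.
by apply: aB => i Fi; rewrite mxE Fv // add0r.
Qed.

Lemma arrangementP v : V v <-> is_face v finset.set0.
Proof. by split; [apply: closure_is_face | apply: face_closure]. Qed.

End Arrangement.

Lemma wreg_full (S : comPzRingType) (J : set S) s : is_ideal J -> J 1 -> wreg J s.
Proof.
elim: s J => //= a s IHs J iJ J1; split=> [y _|].
  by rewrite -[y]mulr1; apply: idealM.
by apply: IHs; [apply: adj_ideal | apply: sub_adj].
Qed.

Lemma cohen_macaulay_zero (S : comPzRingType) (G : set S) :
  ideal_gen G 1 -> cohen_macaulay (qring G).
Proof.
move=> /qpi_eq0 G1 Q [iQ Q1 _]; case: Q1; rewrite -(qpi1 G) G1.
exact: ideal0.
Qed.

Lemma has_krull_dim_uniq (S : comPzRingType) d e :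
  has_krull_dim S d -> has_krull_dim S e -> d = e.
Proof.
move=> [[P cP] dmax] [[P' cP'] emax]; apply/eqP.
by rewrite eqn_leq (emax _ _ cP) (dmax _ _ cP').
Qed.

(** * Exponent complexes at the points of the box *)

Section Boxes.
Variables (k : fieldType) (n : nat) (U : 'X_{1..n} -> Prop) (N' : nat).
Local Notation S := {mpoly k[n]}.
Local Notation N := N'.+1.
Local Notation box := {ffun 'I_n -> 'I_N}.
Hypothesis upU : upset U.
Hypothesis boundU : forall m, U m -> U [multinom minn (m i) N' | i < n].
Implicit Types (b : box) (F G : {set 'I_n}) (m : 'X_{1..n}).

Definition box_face b F := forall m, U m -> exists2 i, i \notin F & (b i < m i)%N.

Definition box_cx b : {set {set 'I_n}} := [set F | `[< box_face b F >]]%SET.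

Definition box_ideal b : set S := monid (fun m => U (mshift b m)).

(** The number [d] counts vertices: the complex has dimension [d - 1]. *)
Definition box_dim b d :=
  (exists2 F : {set 'I_n}, #|F| = d & box_face b F) /\ forall F, box_face b F -> (#|F| <= d)%N.

Lemma box_upset b : upset (fun m => U (mshift b m)).
Proof.
move=> m m' /mnm_lepP mm'; apply: upU; apply/mnm_lepP => i.
by rewrite !mnmE leq_add2l leq_mul2r mm' orbT.
Qed.

Lemma box_faceW b F G : G \subset F -> box_face b F -> box_face b G.
Proof.
move=> /fintype.subsetP GF bF m /bF[i Fi bi]; exists i => //.
by apply: contra Fi; apply: GF.
Qed.

(** A monomial witnessing that [F] is not a face may be cut off at exponents [N' < N], and then
    divides the one of exponent [mshift b (mesym1 F)]. *)
Lemma box_face_shift b F : U (mshift b (mesym1 F)) <-> ~ box_face b F.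
Proof.
split=> [Ub bF|nF].
  by have [i Fi] := bF _ Ub; rewrite !mnmE (negbTE Fi) addn0 ltnn.
have [m Um mb] : exists2 m, U m & forall i, i \notin F -> (m i <= b i)%N.
  apply: contrapT => nom; apply: nF => m Um; apply: contrapT => noi.
  apply: nom; exists m => // i Fi; rewrite leqNgt; apply/negP => lt.
  by apply: noi; exists i.
apply: upU (boundU Um); apply/mnm_lepP => i; rewrite !mnmE.
have [Fi|Fi] := boolP (i \in F).
  by rewrite mul1n (leq_trans (geq_minr _ _)) // (leq_trans (leqnSn _)) // leq_addl.
by rewrite (leq_trans (geq_minl _ _)) // addn0; apply: mb.
Qed.

(** The support of a monomial decides whether it lies in the component, which is therefore generated
    by the squarefree monomials of the non-faces. *)
Lemma box_ideal_gen b :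
  ideal_gen [set (\prod_(i in F) 'X_i : S) | F in [set F : {set 'I_n} | F \notin box_cx b]]
  = box_ideal b.
Proof.
have prodE F : \prod_(i in F) 'X_i = 'X_[mesym1 F] :> S.
  rewrite mpolyXE_id [RHS](bigID [pred i | i \in F]) /= [X in _ * X]big1 ?mulr1.
    by apply: eq_bigr => i Fi; rewrite mnmE Fi.
  by move=> i Fi; rewrite mnmE (negbTE Fi).
have iJ := monid_ideal k (@box_upset b).
apply/seteqP; split.
  move=> p Gp; apply: (Gp _ iJ) => _ [F /= nF <-].
  rewrite prodE; apply/monidX; apply/box_face_shift.
  by move: nF; rewrite inE => /asboolP.
move=> p bp; have iG := ideal_genP [set (\prod_(i in F) 'X_i : S) |
  F in [set F : {set 'I_n} | F \notin box_cx b]].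
apply: (monomial_sum_in iG) => m /bp Ubm.
pose F := [set i | m i != 0%N]%SET.
have -> : m = (mesym1 F + (m - mesym1 F))%MM.
  rewrite addmC submK //; apply/mnm_lepP => i; rewrite mnmE inE.
  by case: (m i).
rewrite mpolyXD; apply: (idealMr _ iG) => K iK sK; apply: sK.
exists F; last exact: prodE.
rewrite /= inE; apply/asboolP => bF; have [j] := bF _ Ubm.
by rewrite inE negbK mnmE => /eqP ->; rewrite mul0n addn0 ltnn.
Qed.

Lemma box_faces_le b d : box_dim b d ->
  forall G, (d < #|G|)%N -> U (mshift b (mesym1 G *+ 1)%MM).
Proof.
move=> [_ dmax] G dG; rewrite mulm1n; apply/box_face_shift => /dmax.
by rewrite leqNgt dG.
Qed.

Lemma box_face_dim b d : box_dim b d ->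
  exists2 F : {set 'I_n}, #|F| = d & forall m, U (mshift b m) -> varU F m.
Proof.
move=> [[F Fd bF] _]; exists F => // m /bF[i Fi].
rewrite mnmE -{1}[nat_of_ord (b i)]addn0 ltn_add2l => mi; exists i => //.
by case: (m i) mi.
Qed.

Lemma box_cm_wreg b d : box_dim b d ->
  cx_cohen_macaulay k (box_cx b) <-> wreg (box_ideal b) (esyms k n 1 d).
Proof.
move=> bd; split=> [cm|rb].
  exact: (crit_wreg (N := 1) (@box_upset b) (box_ideal_gen b) isT
    (box_faces_le bd) (box_face_dim bd) cm).
exact: (crit_cm (N := 1) (@box_upset b) (box_ideal_gen b) isT (box_faces_le bd)
  (box_face_dim bd) rb).
Qed.

Lemma box_dim_exists b : box_face b finset.set0 -> exists d, box_dim b d.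
Proof.
move=> b0; have b0' : `[< box_face b finset.set0 >] by apply/asboolP.
have [F /asboolP bF Fmax] :=
  @arg_maxnP _ finset.set0 (fun F => `[< box_face b F >]) (fun F => #|F|) b0'.
exists #|F|; split; first by exists F.
by move=> G bG; apply: Fmax; apply/asboolP.
Qed.

(** Were [d < e], the elementary symmetric polynomial of degree [d.+1] would be regular although its
    monomials, being non-faces, lie in the ideal; then 1 would lie in [maxid]. *)
Lemma box_wreg_dim b d e : box_dim b d -> (d <= e)%N ->
  wreg (box_ideal b) (esyms k n 1 e) -> d = e.
Proof.
move=> bd; rewrite leq_eqVlt => /predU1P[//|de] rb; exfalso.
have iJ := monid_ideal k (@box_upset b).
have := wreg_nth rb (i := d); rewrite size_esyms nth_esyms // => /(_ de 1).
have iM := prime_ideal_ideal (varU_prime k (finset.set0 : {set 'I_n})).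
suff maxidK : idl (box_ideal b) (take d (esyms k n 1 e)) `<=` @maxid k n.
  have [_ M1 _] := varU_prime k (finset.set0 : {set 'I_n}).
  rewrite mulr1 => dreg; apply: M1; apply: maxidK; apply: dreg.
  apply: sub_idl => //; apply: ideal_sum => // h /eqP hd.
  by apply/monidX; apply: (box_faces_le bd); rewrite hd.
apply: idl_min => //.
  move=> p bp m /bp Um; have [F _ UF] := box_face_dim bd.
  by have [i _ mi] := UF m Um; exists i; rewrite ?inE.
move=> a /mem_take /mapP[j _ ->]; apply: ideal_sum => // h /eqP hj.
apply/monidX; have /card_gt0P[i ih] : (0 < #|h|)%N by rewrite hj.
by exists i; rewrite ?inE // mulmnE mnmE ih.
Qed.

Definition global_dim D :=
  (exists b, exists2 F : {set 'I_n}, #|F| = D & box_face b F) /\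
  forall b F, box_face b F -> (#|F| <= D)%N.

Variables (D : nat) (I : set S).
Hypothesis globalD : global_dim D.
Hypothesis genU : ideal_gen I = monid U.

Let zero_box : box := [ffun => ord0].

Lemma global_faces_le G : (D < #|G|)%N -> U (mesym1 G *+ N)%MM.
Proof.
move=> DG; have -> : (mesym1 G *+ N)%MM = mshift zero_box (mesym1 G).
  by apply/mnmP => i; rewrite mulmnE [RHS]mnmE /zero_box ffunE.
apply/box_face_shift => /(proj2 globalD).
by rewrite leqNgt DG.
Qed.

Lemma global_face_dim : exists2 F : {set 'I_n}, #|F| = D & forall m, U m -> varU F m.
Proof.
have [[b [F FD bF]] _] := globalD; exists F => // m /bF[i Fi mi]; exists i => //.
by case: (m i) mi.
Qed.

Lemma global_krull_dim : has_krull_dim (qring I) D.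
Proof. exact: (crit_dim (N := N) genU global_faces_le global_face_dim). Qed.

Lemma global_cm : cohen_macaulay (qring I) <->
  forall b, box_face b finset.set0 -> box_dim b D /\ cx_cohen_macaulay k (box_cx b).
Proof.
have wregE : wreg (monid U) (esyms k n N D) <->
    forall b, wreg (box_ideal b) (esyms k n 1 D).
  rewrite -(frob_esyms k n N); apply: wreg_frob => //.
    by move=> b; apply: monid_ideal; apply: box_upset.
  exact: monid_comp_in.
split=> [/(crit_wreg (N := N) upU genU isT global_faces_le global_face_dim)/wregE rb b b0|cmb].
  have [d bd] := box_dim_exists b0.
  have dD : d = D.
    apply: (box_wreg_dim bd) (rb b); have [[F <- bF] _] := bd.
    exact: (proj2 globalD) bF.
  by rewrite -dD; split=> //; apply/(box_cm_wreg bd); rewrite dD.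
apply: (crit_cm (N := N) upU genU isT global_faces_le global_face_dim); apply/wregE => b.
have [b0|nb0] := pselect (box_face b finset.set0).
  by have [bd /(box_cm_wreg bd)] := cmb b b0.
(* A void complex has the unit ideal, modulo which every sequence is weakly regular. *)
apply: wreg_full; first exact: monid_ideal (@box_upset b).
rewrite -mpolyX0; apply/monidX; have := (box_face_shift b finset.set0).2 nb0.
by rewrite mesym1_set0.
Qed.

End Boxes.

(** * Reduction of arbitrary points to points of the box *)

Section BoxPoints.
Variables (C : numFieldType) (n : nat) (U : 'X_{1..n} -> Prop) (N' : nat).
Local Notation box := {ffun 'I_n -> 'I_N'.+1}.
Hypothesis upU : upset U.
Hypothesis boundU : forall m, U m -> U [multinom minn (m i) N' | i < n].
Local Notation V := (zariski_closure (@lattice_points C n U)).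

Definition box_point (b : box) : 'rV[C]_n := \row_i (b i)%:R.

Lemma box_pointP (b : box) F : is_face U (box_point b) F <-> box_face U b F.
Proof.
split=> h m Um; have [i Fi] := h m Um.
  rewrite mxE => -[j jm /eqP]; rewrite eqr_nat => /eqP bj.
  by exists i; rewrite ?bj.
by move=> bi; exists i; rewrite // mxE; exists (b i : nat).
Qed.

(* Coordinates outside {0, ..., N' - 1} are replaced by [N'], which no exponent of
   a minimal generator exceeds. *)
Lemma box_of (a : 'rV[C]_n) : exists b : box, forall F, is_face U a F <-> box_face U b F.
Proof.
have /choice[b bP] i : exists j : 'I_N'.+1,
    (a 0 i = j%:R) \/ (nat_of_ord j = N' /\ ~ nat_below (a 0 i) N').
  have [[j jN aj]|nb] := pselect (nat_below (a 0 i) N'); last by exists ord_max; right.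
  by exists (Ordinal (leqW jN)); left.
exists (finfun b) => F; split=> fF m Um; have [i Fi] := fF _ (boundU Um).
  rewrite mnmE => -[j]; rewrite leq_min => /andP[jm jN] aj; exists i => //.
  rewrite ffunE; case: (bP i) => [|[_ []]]; last by exists j.
  by rewrite aj => /eqP; rewrite eqr_nat => /eqP <-.
rewrite mnmE ffunE leq_min => /andP[bm bN]; exists i => //.
case: (bP i) => [ab|[bE _]]; first by exists (b i : nat).
by rewrite bE ltnn in bN.
Qed.

Lemma exponent_complex_box (a : 'rV[C]_n) (b : box) :
  (forall F, is_face U a F <-> box_face U b F) -> exponent_complex V a = box_cx U b.
Proof.
move=> ab; apply/setP => F; rewrite [RHS]inE; apply/idP/asboolP.
  by move/(exponent_complexP upU)/ab.
by move/ab/(exponent_complexP upU).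
Qed.

Lemma box_cx_dim (b : box) d : box_dim U b d <-> cx_has_dim (box_cx U b) (d%:Z - 1).
Proof.
split=> -[[F]].
  move=> Fd bF dmax; split; first by exists F; rewrite ?inE ?Fd //; apply/asboolP.
  move=> G; rewrite inE => /asboolP /dmax.
  by lia.
rewrite inE => /asboolP bF Fd dmax; split.
  by exists F => //; lia.
move=> G bG; have := dmax G; rewrite inE => /(_ (introT (asboolP _) bG)).
by lia.
Qed.

End BoxPoints.

(** * Comparison of the quotient ring with the arrangement *)

Lemma monomial_idealE (k : fieldType) n (I : set {mpoly k[n]}) : monomial_ideal I ->
  upset (fun m => I 'X_[m]) /\ ideal_gen I = monid (fun m => I 'X_[m]).
Proof.
case=> M IE; have iI : is_ideal I by rewrite IE; apply: ideal_genP.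
have upU : upset (fun m => I 'X_[m]).
  by move=> m m' mm' Im; rewrite -(submK mm') mpolyXD; apply: idealM.
split=> //; rewrite ideal_gen_id //; apply/seteqP; split=> [|p Ip].
  rewrite {1}IE => p; apply; first exact: monid_ideal.
  by move=> _ [m Mm <-]; apply/monidX; rewrite IE => K _; apply; exists m.
exact: monomial_sum_in.
Qed.

Lemma box_cx_void (k : fieldType) n (U : 'X_{1..n} -> Prop) N'
    (b : {ffun 'I_n -> 'I_N'.+1}) :
  ~ box_face U b finset.set0 -> cx_cohen_macaulay k (box_cx U b).
Proof.
move=> nb; apply: cohen_macaulay_zero => K _; apply; exists finset.set0.
  by rewrite /= inE; apply/asboolP.
by rewrite big_set0.
Qed.

Theorem corollary5p1 (R : realType) (k : fieldType) (n : nat)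
    (I : set {mpoly k[n]}) (hI : monomial_ideal I) :
  (cohen_macaulay (qring I) <-> real_arrangement_cm k (distracting R I)) /\
  (forall d : nat,
     (cohen_macaulay (qring I) /\ has_krull_dim (qring I) d) <->
     (distracting R I !=set0 /\
      forall a : 'rV[R[i]]_n, distracting R I a ->
        cx_cohen_macaulay k (exponent_complex (distracting R I) a) /\
        cx_has_dim (exponent_complex (distracting R I) a) (d%:Z - 1))).
Proof.
have [upU genU] := monomial_idealE hI.
set U := fun m => I 'X_[m] in upU genU.
have [N' [_ boundU]] := dickson upU.
pose box := {ffun 'I_n -> 'I_N'.+1}.
have VE a : distracting R I a <-> is_face U a finset.set0 by apply: arrangementP.
have cxE a (b : box) : (forall F, is_face U a F <-> box_face U b F) ->
    exponent_complex (distracting R I) a = box_cx U b.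
  exact: exponent_complex_box.
have boxP (a : 'rV[R[i]]_n) := box_of boundU a.
(* For the unit ideal the arrangement is empty and all the complexes are void. *)
have [I1|nI1] := pselect (I 1).
  have noface a F : ~ @is_face R[i] n U a F.
    move=> /(_ 0%MM); rewrite /U mpolyX0 => /(_ I1)[j _ [l]].
    by rewrite mnm0E.
  have noV a : ~ distracting R I a by move=> /VE /noface.
  split; last first.
    move=> d; split=> [[_ [[P [/(_ 0%N isT)[iP P1 _] _]] _]]|[[a /noV]] //].
    case: P1; rewrite -(qpi1 I).
    have -> : qpi I 1 = 0 by apply/qpi_eq0 => K _; apply.
    exact: ideal0.
  split=> _; last by apply: cohen_macaulay_zero => K _; apply.
  split=> [a|]; last by exists 0 => a /noV.
  have [b ab] := boxP (complex_point a); rewrite /real_cm_near (cxE _ _ ab).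
  by apply: box_cx_void => /ab /noface.
pose b0 : box := [ffun => ord0].
have face0 : box_face U b0 finset.set0.
  move=> m Um; apply: contrapT => noi; apply: nI1.
  have m0 : m = 0%MM.
    apply/mnmP => i; rewrite mnm0E; apply/eqP; rewrite -leqn0 leqNgt; apply/negP => mi.
    by apply: noi; exists i; rewrite ?inE // ffunE.
  by move: Um; rewrite /U m0 mpolyX0.
have [D gD] : exists D, global_dim U N' D.
  pose P (bF : box * {set 'I_n}) := `[< box_face U bF.1 bF.2 >].
  have P0 : P (b0, finset.set0) by apply/asboolP.
  have [[b F] /asboolP bF Fmax] := @arg_maxnP _ _ P (fun bF => #|bF.2|) P0.
  exists #|F|; split; first by exists b, F.
  by move=> b' F' bF'; apply: (Fmax (b', F')); apply/asboolP.
have KD := global_krull_dim upU boundU gD genU.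
have CME := global_cm upU boundU gD genU.
have ptE (b : box) : forall F, is_face U (box_point R[i] b) F <-> box_face U b F.
  exact: box_pointP.
have nonvoid (b : box) F : box_face U b F -> box_face U b finset.set0.
  exact: (box_faceW (finset.sub0set F)).
(* A face of the largest size [D] occurs at some box point, which determines the common
   dimension. *)
have attained e : (forall b : box, box_face U b finset.set0 ->
    cx_has_dim (box_cx U b) e) -> e = D%:Z - 1.
  move=> dimb; have [[b [F FD bF]] _] := gD.
  have [[G Gb Ge] maxe] := dimb b (nonvoid b F bF).
  have := maxe F; rewrite inE => /(_ (introT (asboolP _) bF)).
  move: Gb; rewrite inE => /asboolP /(proj2 gD).
  by lia.
have main a : (cohen_macaulay (qring I)) -> distracting R I a ->
    cx_cohen_macaulay k (exponent_complex (distracting R I) a) /\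
    cx_has_dim (exponent_complex (distracting R I) a) (D%:Z - 1).
  move=> /CME cmb /VE aV; have [b ab] := boxP a; rewrite (cxE _ _ ab).
  by have [bD cb] := cmb b ((ab _).1 aV); split=> //; apply/box_cx_dim.
split=> [|d]; last first.
  split=> [[cm dimd]|[_ cmV]].
    rewrite (has_krull_dim_uniq dimd KD); split; last by move=> a; apply: main.
    by exists (box_point R[i] b0); apply/VE/ptE.
  have cmb (b : box) : box_face U b finset.set0 ->
      cx_cohen_macaulay k (box_cx U b) /\ cx_has_dim (box_cx U b) (d%:Z - 1).
    by move=> /ptE /VE /cmV; rewrite (cxE _ _ (ptE b)).
  have dD : d = D.
    by have := attained _ (fun b bb => (cmb b bb).2); lia.
  rewrite dD; split=> //; apply/CME => b /cmb[cb db]; split=> //.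
  by apply/box_cx_dim; rewrite -dD.
split=> [cm|[cmV [e dimV]]].
  split=> [a|]; last by exists (D%:Z - 1) => a /main -/(_ cm)[].
  rewrite /real_cm_near; have [b ab] := boxP (complex_point a).
  have [aV|naV] := pselect (distracting R I (complex_point a)).
    by have [] := main _ cm aV.
  by rewrite (cxE _ _ ab); apply: box_cx_void => /ab /VE.
(* The box points are real, so the condition at real points covers all the complexes in [CME]. *)
have ptR (b : box) : complex_point (box_point R b) = box_point R[i] b.
  by apply/rowP => i; rewrite !mxE rmorph_nat.
have dimb (b : box) : box_face U b finset.set0 -> cx_has_dim (box_cx U b) e.
  move=> /ptE /VE; rewrite -ptR => /dimV.
  by rewrite ptR (cxE _ _ (ptE b)).
apply/CME => b bb; split.
  by apply/box_cx_dim; rewrite -(attained _ dimb); apply: dimb.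
have := cmV (box_point R b); rewrite /real_cm_near ptR.
by rewrite (cxE _ _ (ptE b)).
Qed.
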